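(* Let $d\ge 2$. There exists a purely unrectifiable set $A\subset\mathbb{R}^d$ which has Hausdorff dimension and box counting dimension equal to $d-1$ and which is not tube null.
   Context: A tube $T$ of width $w=w(T)>0$ is the $w$-neighborhood of some line in $\mathbb{R}^d$. A set $A\subset\mathbb{R}^d$ is tube null if for every $\delta>0$ it can be covered by countably many tubes $\{T_j\}$ with $\sum_j w(T_j)^{d-1}\le\delta$. A set $A\subset\mathbb{R}^d$ is purely unrectifiable if $\mathcal{H}^1(A\cap\Gamma)=0$ for every continuously differentiable curve $\Gamma\subset\mathbb{R}^d$, where $\mathcal{H}^1$ is $1$-dimensional Hausdorff measure (length). *)

(* Defs.v *)
From mathcomp Require Import all_boot all_order all_algebra.
From mathcomp Require Import all_classical all_reals all_analysis.

Set Implicit Arguments.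
Unset Strict Implicit.
Unset Printing Implicit Defensive.

Import Order.TTheory GRing.Theory Num.Theory.
Import numFieldNormedType.Exports.

Local Open Scope classical_set_scope.
Local Open Scope ring_scope.

(* Euclidean norm; the library norm `|x| on 'rV[R]_d is the sup norm.         *)
Definition enorm (R : realType) (d : nat) (x : 'rV[R]_d) : R :=
  Num.sqrt (\sum_(i < d) x ord0 i ^+ 2).

(* -oo on the empty set                                                       *)
Definition diam (R : realType) (d : nat) (U : set 'rV[R]_d) : \bar R :=
  ereal_sup [set (enorm (p.1 - p.2))%:E | p in U `*` U].

(* The term diam(U)^s of a Hausdorff sum. The empty set contributes 0, also   *)
(* for s = 0; since 0 `^ 0 = 1, a point contributes 1 when s = 0.             *)
Definition hausdorff_gauge (R : realType) (d : nat) (s : R)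
    (U : set 'rV[R]_d) : \bar R :=
  if U == set0 then 0%E else (diam U `^ s)%E.

Definition hausdorff_premeasure (R : realType) (d : nat) (s delta : R)
    (A : set 'rV[R]_d) : \bar R :=
  ereal_inf [set (\sum_(0 <= i <oo) hausdorff_gauge s (U i))%E |
    U in [set U : (set 'rV[R]_d)^nat |
      (forall i, (diam (U i) <= delta%:E)%E) /\ A `<=` \bigcup_i U i]].

(* The limit as delta -> 0+ is a supremum, by monotonicity in delta.          *)
Definition hausdorff_measure (R : realType) (d : nat) (s : R)
    (A : set 'rV[R]_d) : \bar R :=
  ereal_sup [set hausdorff_premeasure s delta A |
    delta in [set delta : R | 0 < delta]].

Definition hausdorff_dim (R : realType) (d : nat) (A : set 'rV[R]_d) :
    \bar R :=
  ereal_inf [set s%:E | s in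
    [set s : R | 0 <= s /\ hausdorff_measure s A = 0%E]].

(* Least number of sets of diameter at most r covering A; +oo if A has no     *)
(* finite such cover, so that unbounded sets have infinite box dimensions.    *)
Definition covering_number (R : realType) (d : nat) (A : set 'rV[R]_d)
    (r : R) : \bar R :=
  ereal_inf [set (n%:R : R)%:E | n in [set n : nat |
    exists U : (set 'rV[R]_d)^nat,
      (forall i, (i < n)%N -> (diam (U i) <= r%:E)%E) /\
      A `<=` \bigcup_(i in `I_n) U i]].

Definition box_ratio (R : realType) (d : nat) (A : set 'rV[R]_d) (r : R) :
    \bar R :=
  (lne (covering_number A r) * ((ln r^-1)^-1)%:E)%E.

Definition upper_box_dim (R : realType) (d : nat) (A : set 'rV[R]_d) :
    \bar R := limf_esup (box_ratio A) (0 : R)^'+.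

Definition lower_box_dim (R : realType) (d : nat) (A : set 'rV[R]_d) :
    \bar R := limf_einf (box_ratio A) (0 : R)^'+.

Definition has_box_dim (R : realType) (d : nat) (A : set 'rV[R]_d)
    (s : \bar R) : Prop :=
  lower_box_dim A = s /\ upper_box_dim A = s.

(* A C^1 curve is the image of a (possibly unbounded) interval. Asking for    *)
(* two-sided derivatives at endpoints belonging to I loses no curve: a C^1    *)
(* map with one-sided derivatives there extends affinely past them.           *)
Definition c1_curve (R : realType) (d : nat) (G : set 'rV[R]_d) : Prop :=
  exists (I : interval R) (g : R -> 'rV[R]_d),
    [/\ {in I, forall t, derivable g t 1},
        {within [set` I], continuous (derive1 g)} &
        G = g @` [set` I]].

Definition purely_unrectifiable (R : realType) (d : nat)
    (A : set 'rV[R]_d) : Prop :=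
  forall G : set 'rV[R]_d, c1_curve G -> hausdorff_measure 1 (A `&` G) = 0%E.

Definition line (R : realType) (d : nat) (L : set 'rV[R]_d) : Prop :=
  exists p v : 'rV[R]_d, v != 0 /\ L = [set p + t *: v | t in [set: R]].

Definition tube (R : realType) (d : nat) (w : R) (T : set 'rV[R]_d) : Prop :=
  0 < w /\ exists L : set 'rV[R]_d, line L /\
    T = [set x | exists2 y, L y & enorm (x - y) < w].

(* The index set J lets the countable family be finite or infinite.           *)
Definition tube_null (R : realType) (d : nat) (A : set 'rV[R]_d) : Prop :=
  forall delta : R, 0 < delta ->
  exists (J : set nat) (T : nat -> set 'rV[R]_d) (w : nat -> R),
    [/\ forall j, J j -> tube (w j) (T j),
        A `<=` \bigcup_(j in J) T j &
        (\esum_(j in J) (w j ^+ d.-1)%:E <= delta%:E)%E].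

(* Main.v *)
Require Import Defs.
From mathcomp Require Import all_boot all_order all_algebra.
From mathcomp Require Import all_classical all_reals all_analysis.
From mathcomp Require Import zify ring lra.

(* Start from the cube [-1, 1]^d. At step k, cut a cube into N^d blocks, cut each
   block into b^d subcells, and keep a single subcell, slightly shrunk, in every
   block; then iterate, with fast growing N and b. With N = m * b^(d-1), a fraction
   b^-d of the volume survives and a line meets about m kept subcells.
   - Choosing the kept subcells at random, a Chernoff bound over a finite net of
     lines gives a choice for which no line gains more than a factor 1 + eps_k
     over the expected length, at every step. Hence all tubes T of width w contain
     at most a fraction C * w^(d-1) of the cubes of any level finer than w, and by
     compactness the limit set is not tube null.
   - m is small compared with the scale, which gives box dimension d - 1; a set
     that is not tube null has Hausdorff dimension at least d - 1.
   - Kept subcells of different blocks are separated by much more than their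
     diameter, so the number of them met by a Lipschitz curve times their diameter
     tends to 0. *)

Set Implicit Arguments.
Unset Strict Implicit.
Unset Printing Implicit Defensive.

Import Order.TTheory GRing.Theory Num.Theory.
Import numFieldNormedType.Exports.

Local Open Scope classical_set_scope.
Local Open Scope ring_scope.

(** The factor [m] is pulled in two directions. The Chernoff exponent of step k is [m] times a
    factor of order [2^(-4k)], and it has to beat the logarithm of the size of the net of lines,
    which is of the order of [log (1 / r)] for the scale [r] reached by the step; so [m] cannot stay
    bounded. For dimension d - 1, the logarithms of all [m] so far must add up to a negligible part
    of [log (1 / r)]. Moreover [b] has to grow, for the gaps, but one step may change [log (1 / r)]
    only by a small proportion, or the counts at scales between two levels would be too large. With
    [log m] linear and [log b] quadratic in k, [log (1 / r)] is cubic and all these demands are met.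
    Tubes and diameters are Euclidean, while cubes, nets and chord lengths use the sup norm, for
    which cubes are balls; passing from one to the other costs only constants. *)

(** * Random selection by exponential moments *)

Lemma expR_le1D2 (R : realType) (x : R) :
  0 <= x -> x <= 2^-1 -> expR x <= 1 + x + 2 * x ^+ 2.
Proof.
move=> x0 x1.
have h : 1 - x <= expR (- x) := expR_ge1Dx (- x).
have e0 := expR_gt0 x.
have : (1 - x) * expR x <= 1.
  rewrite -[leRHS](expRxMexpNx_1 x) mulrC ler_pM2l //.
move=> h1; have h2 : 1 <= (1 - x) * (1 + x + 2 * x ^+ 2) by nra.
have xp : 0 < 1 - x by lra.
by rewrite -(ler_pM2l xp); apply: (le_trans h1).
Qed.

(* First-moment method for a uniformly random [F], with exponential moments;
   the coordinates of [F] are independent. *)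
Lemma exists_selection (R : realType) (G I J : finType)
    (W : J -> G -> I -> R) (theta : J -> R) :
  (0 < #|I|)%N ->
  \sum_j expR ((#|I|%:R)^-1 * (\sum_g \sum_i (expR (W j g i) - 1)) - theta j)
    < 1 ->
  exists F : {ffun G -> I}, forall j, \sum_g W j g (F g) < theta j.
Proof.
move=> I0 hsum; apply: contrapT => hn.
have q0 : 0 < #|I|%:R :> R by rewrite ltr0n.
(* If every [F] failed at some [j], one term of this sum would be at least 1, so the average over
   all [F] would be at least 1. *)
have hF (F : {ffun G -> I}) :
    1 <= \sum_j expR (\sum_g W j g (F g) - theta j).
  have [j hj] : exists j, theta j <= \sum_g W j g (F g).
    apply: contrapT => hn2; apply: hn; exists F => j.
    by rewrite ltNge; apply/negP => h; apply: hn2; exists j.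
  rewrite (bigD1 j) //= -[leLHS]addr0 lerD //.
    by rewrite -expR0 ler_expR subr_ge0.
  by apply: sumr_ge0 => i _; exact: expR_ge0.
have : (#|{ffun G -> I}|%:R : R) <=
    \sum_(F : {ffun G -> I}) \sum_j expR (\sum_g W j g (F g) - theta j).
  by rewrite -sumr_const; apply: ler_sum => F _; exact: hF.
rewrite exchange_big /= card_ffun natrX leNgt => /negP; apply.
rewrite -[ltRHS]mul1r.
apply: le_lt_trans (_ : _ <= (\sum_j expR ((#|I|%:R)^-1 *
  (\sum_g \sum_i (expR (W j g i) - 1)) - theta j)) * #|I|%:R ^+ #|G|) _;
  last by rewrite ltr_pM2r // exprn_gt0.
rewrite mulr_suml; apply: ler_sum => j _.
under eq_bigr do rewrite expRD expR_sum.
(* Independence: the sum over all [F] of a product over [g] is the product of the sums over [i].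
   Each factor is then bounded by [1 + x <= expR x]. *)
rewrite -mulr_suml -(bigA_distr_bigA (fun g i => expR (W j g i))) /=.
rewrite expRD mulrAC ler_wpM2r ?expR_ge0 // mulr_sumr expR_sum.
rewrite -prodr_const -big_split /=; apply: ler_prod => g _.
apply/andP; split; first by apply: sumr_ge0 => i _; exact: expR_ge0.
apply: le_trans (_ : (1 + (#|I|%:R)^-1 * \sum_i (expR (W j g i) - 1)) * #|I|%:R <= _).
  rewrite sumrB sumr_const mulrDl mul1r mulrAC mulVf ?gt_eqF // mul1r.
  by rewrite addrC subrK.
by rewrite ler_wpM2r ?ler0n // expR_ge1Dx.
Qed.

(** * Sup norm and lengths of chords of cubes *)

Lemma rV_norm_leP (R : realType) (d : nat) (x : 'rV[R]_d) (r : R) :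
  0 <= r -> (`|x| <= r) <-> (forall i, `|x ord0 i| <= r).
Proof.
move=> r0; rewrite [`|x|]/Num.norm /= mx_normrE; split=> [h i|h].
  by apply: le_trans h; exact: (le_bigmax _ (fun ij : 'I_1 * 'I_d => `|x ij.1 ij.2|) (ord0, i)).
by apply: bigmax_le => // -[i j] _ /=; rewrite ord1.
Qed.

Lemma rV_coord_le (R : realType) (d : nat) (x : 'rV[R]_d) i :
  `|x ord0 i| <= `|x|.
Proof. exact: (rV_norm_leP x (normr_ge0 x)).1. Qed.

Lemma rV_norm_coord (R : realType) (d : nat) (x : 'rV[R]_d) :
  0 < `|x| -> exists i, `|x ord0 i| = `|x|.
Proof.
move=> x0; apply: contrapT => hn.
have [] : ~ (`|x| < `|x|) by rewrite ltxx.
rewrite [ltLHS]/Num.norm /= mx_normrE; apply: bigmax_lt => // -[i j] _ /=.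
rewrite ord1 lt_neqAle rV_coord_le andbT; apply/negP => /eqP h.
by apply: hn; exists j.
Qed.

Section Chord.
Variables (R : realType) (d : nat).
Implicit Types (a v : 'rV[R]_d) (r : R).

Definition chord_set a v r : set R := [set t | `|a + t *: v| <= r].

(** A cube centred at [c] is reached by passing [a - c]. For [|v| = 1] this is a sup-norm length,
    finite by [chord_set_bound], so [fine] loses nothing. *)
Definition chord a v r : R := fine (lebesgue_measure (chord_set a v r)).

Lemma chord_set_measurable a v r : measurable (chord_set a v r).
Proof.
suff /is_intervalP -> : is_interval (chord_set a v r) by exact: measurable_itv.
move=> x y /= hx hy z /andP[xz zy].
have [xy|xy] := ltP x y; last first.
  by have -> : z = x by apply/eqP; rewrite eq_le xz (le_trans zy xy).
rewrite /chord_set /=; pose s := (z - x) / (y - x).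
have yx : 0 < y - x by rewrite subr_gt0.
have s0 : 0 <= s by rewrite divr_ge0 ?subr_ge0 // ltW.
have s1 : s <= 1 by rewrite ler_pdivrMr // mul1r; lra.
have -> : a + z *: v = (1 - s) *: (a + x *: v) + s *: (a + y *: v).
  rewrite 2!scalerDr !scalerA addrACA -!scalerDl subrK scale1r.
  congr (_ + _ *: _); rewrite mulrBl mul1r -addrA [- _ + _]addrC -mulrBr.
  by rewrite /s -mulrA mulVf ?gt_eqF // mulr1 addrC subrK.
have n1 : `|1 - s| = 1 - s by rewrite ger0_norm // subr_ge0.
apply: le_trans (ler_normD _ _) _; rewrite 2!normrZ n1 (ger0_norm s0).
apply: le_trans (_ : (1 - s) * r + s * r <= _).
  by apply: lerD; apply: ler_wpM2l => //; rewrite subr_ge0.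
by rewrite -mulrDl subrK mul1r.
Qed.

Lemma chord_set_sub a v r t0 : `|v| = 1 -> chord_set a v r t0 ->
  chord_set a v r `<=` `[t0 - 2 * r, t0 + 2 * r].
Proof.
move=> v1; rewrite /chord_set /= => h0 t /= ht; rewrite in_itv /=.
have : `|t - t0| <= 2 * r.
  have -> : `|t - t0| = `|(t - t0) *: v| by rewrite normrZ v1 mulr1.
  rewrite scalerBl.
  have -> : t *: v - t0 *: v = (a + t *: v) - (a + t0 *: v).
    by rewrite opprD addrACA subrr add0r.
  by apply: le_trans (ler_normB _ _) _; lra.
by rewrite ler_distl => /andP[? ?]; apply/andP; split; lra.
Qed.

Lemma lebesgue_itvcc (x y : R) : x <= y ->
  lebesgue_measure (`[x, y]%classic : set R) = (y - x)%:E.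
Proof.
rewrite le_eqVlt lebesgue_measure_itv /= lte_fin => /orP[/eqP ->|->].
  by rewrite ltxx subrr.
by rewrite -EFinB.
Qed.

Lemma chord_set_bound a v r : `|v| = 1 ->
  (lebesgue_measure (chord_set a v r) <= (4 * Num.max 0 r)%:E)%E.
Proof.
move=> v1; have [[t0 ht0]|hn] := pselect (exists t, chord_set a v r t).
  have r0 : 0 <= r by apply: le_trans ht0.
  apply: (@le_trans _ _ (lebesgue_measure
      (`[t0 - 2 * r, t0 + 2 * r]%classic : set R))).
    apply: le_measure; rewrite ?inE; last exact: chord_set_sub.
      exact: chord_set_measurable.
    exact: measurable_itv.
  rewrite lebesgue_itvcc; last by lra.
  by rewrite lee_fin (max_r r0); lra.
have -> : chord_set a v r = set0.
  by apply/seteqP; split => // t ht; apply: hn; exists t.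
by rewrite measure0 lee_fin mulr_ge0 // le_max lexx.
Qed.

Lemma chord_fin a v r : `|v| = 1 ->
  lebesgue_measure (chord_set a v r) = (chord a v r)%:E.
Proof.
move=> v1; rewrite /chord fineK // ge0_fin_numE; last exact: measure_ge0.
by apply: le_lt_trans (chord_set_bound a r v1) _; exact: ltry.
Qed.

Lemma chord_ge0 a v r : 0 <= chord a v r.
Proof. by rewrite /chord fine_ge0 // measure_ge0. Qed.

Lemma chord_le a v r : `|v| = 1 -> 0 <= r -> chord a v r <= 4 * r.
Proof.
move=> v1 r0; rewrite -lee_fin -chord_fin //.
by apply: le_trans (chord_set_bound a r v1) _; rewrite (max_r r0).
Qed.

Lemma chord_mono a v r a' v' r' : `|v| = 1 -> `|v'| = 1 ->
  chord_set a v r `<=` chord_set a' v' r' -> chord a v r <= chord a' v' r'.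
Proof.
move=> v1 v1' sub; rewrite -lee_fin -!chord_fin //.
by apply: le_measure; rewrite ?inE //; exact: chord_set_measurable.
Qed.

(** Moving the parameter by [s] moves the point by [s] in sup norm, so a whole interval around [t0]
    stays in the larger cube. This turns one hit into a length. *)
Lemma chord_ge a v r r' t0 : `|v| = 1 -> chord_set a v r t0 -> r <= r' ->
  2 * (r' - r) <= chord a v r'.
Proof.
move=> v1 h0 rr'; rewrite -lee_fin -chord_fin //.
apply: (@le_trans _ _ (lebesgue_measure
  (`[t0 - (r' - r), t0 + (r' - r)]%classic : set R))).
  by rewrite lebesgue_itvcc ?lee_fin; lra.
apply: le_measure; rewrite ?inE; [exact: measurable_itv|exact: chord_set_measurable|].
move=> t /=; rewrite in_itv /= => ht; rewrite /chord_set /=.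
have -> : a + t *: v = (a + t0 *: v) + (t - t0) *: v.
  by rewrite scalerBl -addrA [t0 *: v + _]addrC subrK.
have htt : `|t - t0| <= r' - r by rewrite ler_distl; lra.
apply: le_trans (ler_normD _ _) _; rewrite normrZ v1 mulr1.
by move: h0; rewrite /chord_set /= => h0; lra.
Qed.

Lemma chord_eq0 a v r : (forall t, ~ chord_set a v r t) -> chord a v r = 0.
Proof.
move=> h; rewrite /chord (_ : chord_set a v r = set0) ?measure0 //.
by apply/seteqP; split.
Qed.

(** Disjoint cubes inside a cube cut disjoint pieces out of its chord; strict separation makes the
    pieces disjoint up to the boundary. *)
Lemma sum_chord_le (I : finType) (c : I -> 'rV[R]_d) a v r r' : `|v| = 1 ->
  (forall i, `|c i| + r <= r') ->
  (forall i j, i != j -> 2 * r < `|c i - c j|) ->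
  \sum_i chord (a - c i) v r <= chord a v r'.
Proof.
move=> v1 hin hdis.
have hU : \bigcup_(i in [set: I]) chord_set (a - c i) v r `<=` chord_set a v r'.
  move=> t [i _]; rewrite /chord_set /= => h.
  have -> : a + t *: v = (a - c i + t *: v) + c i by rewrite addrAC subrK.
  by apply: le_trans (ler_normD _ _) _; apply: le_trans (hin i); rewrite addrC lerD2l.
rewrite -lee_fin -chord_fin // -sumEFin.
under eq_bigr do rewrite -chord_fin //.
apply: (@le_trans _ _ (lebesgue_measure
   (\bigcup_(i in [set: I]) chord_set (a - c i) v r))); last first.
  apply: le_measure; rewrite ?inE //; last exact: chord_set_measurable.
  by apply: fin_bigcup_measurable => [|i _]; [exact: finite_finset|exact: chord_set_measurable].
rewrite measure_fin_bigcup //=.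
- rewrite -big_enum fsbig_seq ?enum_uniq //= (_ : [set` enum I] = setT) //.
  by apply/seteqP; split => // i _ /=; rewrite mem_enum.
- move=> i j _ _ [t []]; rewrite /chord_set /= => hi hj.
  apply/eqP; apply: contraT => /hdis; rewrite ltNge => /negP; case.
  have -> : c i - c j = (a - c j + t *: v) - (a - c i + t *: v).
    by rewrite opprD addrACA subrr addr0 opprB addrC addrA subrK.
  by apply: le_trans (ler_normB _ _) _; lra.
- by move=> i _; exact: chord_set_measurable.
Qed.

End Chord.

(** * Grids of cells; blocks and subcells *)

Section Grid.
Variables (R : realType) (d : nat).

(* Centres of the cells of half-width [r] tiling the cube of half-width
   [n * r] centred at the origin. *)
Definition gridpt (n : nat) (r : R) (g : {ffun 'I_d -> 'I_n}) : 'rV[R]_d :=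
  \row_i (r * ((g i).*2.+1%:R - n%:R)).

Lemma gridpt_norm n (r : R) (g : {ffun 'I_d -> 'I_n}) : (0 < n)%N -> 0 <= r ->
  `|gridpt r g| + r <= n%:R * r.
Proof.
move=> n0 r0; have n1 : 1 <= n%:R :> R by rewrite ler1n.
rewrite -lerBrDr; apply/rV_norm_leP => [|i]; first nra.
rewrite mxE normrM (ger0_norm r0) -{3}[r]mul1r -mulrBl mulrC ler_wpM2r //.
have := ltn_ord (g i); move: (g i : nat) => k kn.
have kn' : k.+1%:R <= n%:R :> R by rewrite ler_nat.
rewrite -[k.*2.+1]addn1 -muln2 natrD natrM; rewrite -natr1 in kn'.
have := ler0n R k; rewrite ler_norml; lra.
Qed.

Lemma gridpt_sep n (r : R) (g h : {ffun 'I_d -> 'I_n}) : 0 <= r -> g != h ->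
  2 * r <= `|gridpt r g - gridpt r h|.
Proof.
move=> r0 gh; have [i gi] : exists i, g i != h i.
  apply: contrapT => hn; move/eqP: gh; apply; apply/ffunP => i.
  by apply/eqP; apply: contraT => hi; case: hn; exists i.
apply: le_trans (rV_coord_le _ i); rewrite !mxE -mulrBr opprB addrA subrK.
rewrite normrM (ger0_norm r0) mulrC ler_wpM2l //.
have {gi} : (g i : nat) != h i by [].
move: (g i : nat) (h i : nat) => k l; rewrite neq_ltn -(ltr_nat R) -[(l < k)%N](ltr_nat R).
rewrite -[k.*2.+1]addn1 -[l.*2.+1]addn1 -!muln2 !natrD !natrM.
case/orP => [kl|kl].
- have h1 : k.+1%:R <= l%:R :> R by rewrite ler_nat -(ltr_nat R).
  by rewrite ler_normr; apply/orP; right; rewrite -natr1 in h1; lra.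
- have h1 : l.+1%:R <= k%:R :> R by rewrite ler_nat -(ltr_nat R).
  by rewrite ler_normr; apply/orP; left; rewrite -natr1 in h1; lra.
Qed.

End Grid.

Section OneStep.
Variables (R : realType) (d : nat) (N b : nat) (rho gam : R).
Hypotheses (N0 : (0 < N)%N) (b0 : (0 < b)%N) (rho0 : 0 < rho).
Hypotheses (gam0 : 0 < gam) (gam1 : gam <= 2^-1).

(** Half-widths of a block and of a subcell. The subcells tile only the part [1 - gam] of the block,
    which leaves a margin along its border. *)
Let kap : R := rho / N%:R.
Let sig : R := (1 - gam) * rho / (N * b)%:R.

Let Nr0 : 0 < N%:R :> R. Proof. by rewrite ltr0n. Qed.
Let br0 : 0 < b%:R :> R. Proof. by rewrite ltr0n. Qed.

Let kap0 : 0 < kap. Proof. by rewrite divr_gt0. Qed.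

Let sig0 : 0 < sig.
Proof.
have g1 : 0 < 1 - gam by move: gam1; lra.
by apply: divr_gt0; [exact: mulr_gt0|rewrite ltr0n muln_gt0 N0].
Qed.

Let Nkap : N%:R * kap = rho. Proof. by rewrite mulrC divfK ?gt_eqF. Qed.

Let bsig : b%:R * sig = (1 - gam) * kap.
Proof. by rewrite /sig /kap natrM; field; rewrite !gt_eqF. Qed.

Definition subcell (g : {ffun 'I_d -> 'I_N}) (f : {ffun 'I_d -> 'I_b}) :
  'rV[R]_d := gridpt kap g + gridpt sig f.

Lemma subcell_norm g f : `|subcell g f| + sig <= rho.
Proof.
have h1 := gridpt_norm g N0 (ltW kap0); rewrite Nkap in h1.
have h2 := gridpt_norm f b0 (ltW sig0); rewrite bsig in h2.
have h3 : 0 <= gam * kap by rewrite mulr_ge0 ?ltW.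
have := ler_normD (gridpt kap g) (gridpt sig f); rewrite -/(subcell g f); lra.
Qed.

(** Block centres are [2 * kap] apart, and a subcell centre is within [(1 - gam) * kap - sig] of the
    centre of its block. *)
Lemma subcell_block_sep g g' f f' : g != g' ->
  2 * gam * kap + 2 * sig <= `|subcell g f - subcell g' f'|.
Proof.
move=> gg; have h := gridpt_sep (ltW kap0) gg.
have h2 := gridpt_norm f b0 (ltW sig0); rewrite bsig in h2.
have h3 := gridpt_norm f' b0 (ltW sig0); rewrite bsig in h3.
have -> : subcell g f - subcell g' f' =
    (gridpt kap g - gridpt kap g') - (gridpt sig f' - gridpt sig f).
  by rewrite /subcell opprB opprD addrACA [_ - gridpt sig f']addrC.
have := lerB_dist (gridpt kap g - gridpt kap g') (gridpt sig f' - gridpt sig f).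
have := ler_normB (gridpt sig f') (gridpt sig f).
by lra.
Qed.

Lemma subcell_sep p p' : p != p' ->
  2 * sig <= `|subcell p.1 p.2 - subcell p'.1 p'.2|.
Proof.
case: p p' => [g f] [g' f'] /=; have [->|gg _] := eqVneq g g'.
  rewrite xpair_eqE eqxx /= => ff; rewrite /subcell opprD addrACA subrr add0r.
  exact: gridpt_sep (ltW sig0) ff.
have := subcell_block_sep f f' gg; have : 0 <= gam * kap by rewrite mulr_ge0 ?ltW.
lra.
Qed.

End OneStep.

(** * A finite net of lines and the selection at one step *)

Lemma truncn_div_inj (R : realType) (K : nat) (h x y : R) : 0 < h -> 0 <= x -> 0 <= y ->
  x < K.+1%:R * h -> y < K.+1%:R * h ->
  inord (Num.truncn (x / h)) = inord (Num.truncn (y / h)) :> 'I_K.+1 ->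
  `|x - y| <= h.
Proof.
move=> h0 x0 y0 xK yK.
have xh0 : 0 <= x / h by rewrite divr_ge0 // ltW.
have yh0 : 0 <= y / h by rewrite divr_ge0 // ltW.
have xt : (Num.truncn (x / h) < K.+1)%N by rewrite truncn_lt_nat // ltr_pdivrMr.
have yt : (Num.truncn (y / h) < K.+1)%N by rewrite truncn_lt_nat // ltr_pdivrMr.
move=> /(congr1 val) /=; rewrite !inordK // => e.
have /andP[x1 x2] := truncn_itv xh0; have /andP[y1 y2] := truncn_itv yh0.
rewrite e in x1 x2; move: x1 x2 y1 y2; rewrite -natr1.
set k := (_%:R : R); rewrite ler_pdivlMr // ltr_pdivrMr // ler_pdivlMr // ltr_pdivrMr //.
rewrite mulrDl mul1r => ? ? ? ?.
rewrite ler_norml; apply/andP; split; lra.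
Qed.

Section LineNet.
Variables (R : realType) (d K : nat) (h : R).

(** Rounds base point and direction to a mesh [h]. The shift by 6 makes coordinates in [-6, 6]
    nonnegative, and [12 < K.+1%:R * h] keeps the quotients in the range where [inord] does not fall
    back to its default. The number of keys is [K.+1 ^ (2 * d)]. *)
Definition line_key (l : 'rV[R]_d * 'rV[R]_d) :
    {ffun 'I_d -> 'I_K.+1 * 'I_K.+1} :=
  [ffun i => (inord (Num.truncn ((l.1 ord0 i + 6) / h)),
              inord (Num.truncn ((l.2 ord0 i + 6) / h)))].

Lemma line_key_close l l' : 0 < h -> 12 < K.+1%:R * h ->
  `|l.1| <= 6 -> `|l.2| = 1 -> `|l'.1| <= 6 -> `|l'.2| = 1 ->
  line_key l = line_key l' ->
  `|l.1 - l'.1| <= h /\ `|l.2 - l'.2| <= h.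
Proof.
move=> h0 hK a1 v1 a1' v1' e.
have bnd (x : 'rV[R]_d) i : `|x| <= 6 ->
    0 <= x ord0 i + 6 /\ x ord0 i + 6 < K.+1%:R * h.
  move=> x6; have := le_trans (rV_coord_le x i) x6.
  by rewrite ler_norml => /andP[? ?]; split; lra.
split; apply/rV_norm_leP => [|i]; rewrite ?(ltW h0) //;
  move/ffunP: e => /(_ i); rewrite !ffunE => -[e1 e2]; rewrite !mxE.
- have [? ?] := bnd _ i a1; have [? ?] := bnd _ i a1'.
  have -> : l.1 ord0 i - l'.1 ord0 i = (l.1 ord0 i + 6) - (l'.1 ord0 i + 6) by ring.
  exact: truncn_div_inj e1.
- have v6 : `|l.2| <= 6 by rewrite v1 ler1n.
  have v6' : `|l'.2| <= 6 by rewrite v1' ler1n.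
  have [? ?] := bnd _ i v6; have [? ?] := bnd _ i v6'.
  have -> : l.2 ord0 i - l'.2 ord0 i = (l.2 ord0 i + 6) - (l'.2 ord0 i + 6) by ring.
  exact: truncn_div_inj e2.
Qed.

End LineNet.

(** Only parameters with [|t| <= T] can reach the cube, and for these the point moves by at most
    [h + T * h]. *)
Lemma chord_set_perturb (R : realType) (d : nat) (a v a' v' c : 'rV[R]_d)
    (r h T : R) :
  `|v| = 1 -> `|a - c| + r <= T -> `|a - a'| <= h -> `|v - v'| <= h ->
  chord_set (a - c) v r `<=` chord_set (a' - c) v' (r + (1 + T) * h).
Proof.
move=> v1 hT ha hv t; rewrite /chord_set /= => ht.
have h0 : 0 <= h by apply: le_trans ha.
have tT : `|t| <= T.
  have -> : `|t| = `|t *: v| by rewrite normrZ v1 mulr1.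
  have -> : t *: v = (a - c + t *: v) - (a - c) by rewrite addrAC subrr add0r.
  by apply: le_trans (ler_normB _ _) _; lra.
have -> : a' - c + t *: v' = (a - c + t *: v) - ((a - a') + t *: (v - v')).
  rewrite scalerBr opprD !opprB addrACA [t *: v + _]addrC subrK.
  by rewrite [a - c + _]addrC addrA subrK.
apply: le_trans (ler_normB _ _) _; apply: lerD => //.
apply: le_trans (ler_normD _ _) _; rewrite normrZ mulrDl mul1r; apply: lerD => //.
by apply: ler_pM.
Qed.

(* Each line is compared with the representative of its rounding class: the gaps
   between subcells absorb the rounding error, and the enlarged cube on the right
   absorbs the additive error of the Chernoff bound, since a line that meets a
   subcell has a chord of length at least [2 * gam * rho] in it. *)
Lemma one_step (R : realType) (d N b K : nat) (rho gam e1 : R) :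
  let sig := (1 - gam) * rho / (N * b)%:R in
  (0 < N)%N -> (0 < b)%N -> 0 < rho -> rho <= 1 -> 0 < gam -> gam <= 2^-1 ->
  0 < e1 -> e1 <= 1 -> 432 < K.+1%:R * (gam * sig) ->
  K.+1%:R ^+ (2 * d) * expR (- (e1 ^+ 2 * (N * b)%:R / (2 * b%:R ^+ d))) < 1 ->
  exists F : {ffun {ffun 'I_d -> 'I_N} -> {ffun 'I_d -> 'I_b}},
    forall a v r', `|a| <= 6 -> `|v| = 1 -> r' <= (1 - gam / 2) * sig ->
    \sum_g chord (a - subcell rho gam g (F g)) v r' <=
    (1 + 4 * e1 / gam) / b%:R ^+ d * chord a v ((1 + gam) * rho).
Proof.
move=> sig N0 b0 rho0 rho1 gam0 gam1 e0 e11 hK hprob.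
have Nb0 : 0 < (N * b)%:R :> R by rewrite ltr0n muln_gt0 N0 b0.
have q0 : 0 < b%:R ^+ d :> R by rewrite exprn_gt0 // ltr0n.
have g1 : 0 < 1 - gam by lra.
have sig0 : 0 < sig by rewrite divr_gt0 // mulr_gt0.
have sigrho : sig * (N * b)%:R <= rho.
  by rewrite /sig divfK ?gt_eqF // ler_piMl ?(ltW rho0) //; lra.
have sigrho' : sig <= rho.
  by apply: le_trans sigrho; rewrite ler_peMr ?(ltW sig0) // ler1n muln_gt0 N0.
have cardI : #|{ffun 'I_d -> 'I_b}|%:R = b%:R ^+ d :> R.
  by rewrite card_ffun !card_ord natrX.
(* Here [T = 8] in [chord_set_perturb], so rounding costs [9 * mesh = gam * sig / 4]. The constant
   432 is [12 * 36], with 12 the length of [-6, 6]. *)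
pose mesh := gam * sig / 36.
have mesh0 : 0 < mesh by rewrite divr_gt0 // mulr_gt0.
have meshK : 12 < K.+1%:R * mesh.
  by rewrite /mesh mulrA ltr_pdivlMr //; lra.
(* Unit vectors are missing only for [d = 0], where the claim is vacuous. *)
have [[v0 hv0]|hn] := pselect (exists v : 'rV[R]_d, `|v| = 1); last first.
  have f0 : {ffun 'I_d -> 'I_b} := [ffun=> Ordinal b0].
  have F0 : {ffun {ffun 'I_d -> 'I_N} -> {ffun 'I_d -> 'I_b}} := [ffun=> f0].
  exists F0 => a v r' _ v1.
  by case: hn; exists v.
pose valid (l : 'rV[R]_d * 'rV[R]_d) := `|l.1| <= 6 /\ `|l.2| = 1.
(* A key that comes from no line gets the default line [(0, v0)], so that [rep] is total and always
   valid. *)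
have repP j : exists l, valid l /\
    ((exists l', valid l' /\ line_key K mesh l' = j) -> line_key K mesh l = j).
  have [[l [vl lj]]|hn] := pselect (exists l', valid l' /\ line_key K mesh l' = j).
    by exists l.
  exists (0, v0); split=> [|h]; last by case: hn.
  by split => //=; rewrite normr0.
pose rep j := sval (cid (repP j)).
have rep_valid j : valid (rep j) by rewrite /rep; case: cid => l [].
have rep_key l : valid l -> line_key K mesh (rep (line_key K mesh l)) = line_key K mesh l.
  by move=> vl; rewrite /rep; case: cid => l' [_] /=; apply; exists l.
(* One rounding error above [(1 - gam / 2) * sig], yet strictly below [sig], so that cubes of
   half-width [s] in distinct subcells remain disjoint. *)
pose s := (1 - gam / 4) * sig.
have s0 : 0 < s by rewrite mulr_gt0 //; lra.
have ssig : s < sig by rewrite -[ltRHS]mul1r ltr_pM2r //; lra.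
(* Chords in a subcell are at most [4 * sig], so [x = mu * V] is at most [e1 / 2] and
   [expR x - 1 <= (1 + e1) * x]. *)
pose mu := e1 / (8 * sig).
have mu0 : 0 < mu by rewrite divr_gt0 // mulr_gt0.
have musig : mu * sig = e1 / 8 by rewrite /mu; field; rewrite gt_eqF.
pose V j (g : {ffun 'I_d -> 'I_N}) (f : {ffun 'I_d -> 'I_b}) :=
  chord ((rep j).1 - subcell rho gam g f) (rep j).2 s.
have sumV j : \sum_g \sum_f V j g f <= chord (rep j).1 (rep j).2 rho.
  rewrite pair_big /=; apply: (@sum_chord_le _ _ _ (fun p => subcell rho gam p.1 p.2)).
  - by case: (rep_valid j).
  - move=> p; apply: le_trans (subcell_norm N0 b0 rho0 gam0 gam1 p.1 p.2).
    by rewrite lerD2l -/sig ltW.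
  - move=> p p' pp; apply: lt_le_trans (subcell_sep N0 b0 rho0 gam0 gam1 pp).
    by rewrite -/sig ltr_pM2l.
have V0 j g f : 0 <= V j g f by exact: chord_ge0.
have Vs j g f : V j g f <= 4 * sig.
  apply: le_trans (chord_le _ _ (ltW s0)) _; first by case: (rep_valid j).
  by rewrite ler_pM2l // ltW.
have crho j : chord (rep j).1 (rep j).2 rho <= 4 * rho.
  by apply: chord_le; rewrite ?ltW //; case: (rep_valid j).
(* The threshold is the mean plus a slack. As the chords total at most [4 * rho], the quadratic
   error of the exponential uses at most half of the slack; the other half and
   [mu * rho >= e1 * N * b / 8] give the exponent in the hypothesis. *)
have [F hF] : exists F : {ffun {ffun 'I_d -> 'I_N} -> {ffun 'I_d -> 'I_b}},
    forall j, \sum_g mu * V j g (F g) <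
      (b%:R ^+ d)^-1 * (mu * \sum_g \sum_f V j g f) +
      8 * e1 * mu * rho / b%:R ^+ d.
  apply: (@exists_selection R _ _ _ (fun j g f => mu * V j g f)
    (fun j => (b%:R ^+ d)^-1 * (mu * \sum_g \sum_f V j g f) +
      8 * e1 * mu * rho / b%:R ^+ d)); first by rewrite card_ffun !card_ord expn_gt0 b0.
  rewrite cardI; apply: le_lt_trans hprob.
  have -> : K.+1%:R ^+ (2 * d) =
      #|{: {ffun 'I_d -> 'I_K.+1 * 'I_K.+1}}|%:R :> R.
    by rewrite card_ffun card_prod !card_ord natrX natrM -expr2 exprM.
  rewrite [leRHS]mulr_natl -[leRHS]sumr_const; apply: ler_sum => j _; rewrite ler_expR.
  apply: le_trans (_ : (b%:R ^+ d)^-1 * ((1 + e1) * (mu * \sum_g \sum_f V j g f)) -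
    ((b%:R ^+ d)^-1 * (mu * \sum_g \sum_f V j g f) + 8 * e1 * mu * rho / b%:R ^+ d) <= _).
    rewrite lerD2r ler_pM2l ?invr_gt0 // mulrA mulr_sumr; apply: ler_sum => g _.
    rewrite mulr_sumr; apply: ler_sum => f _.
    have x0 : 0 <= mu * V j g f by rewrite mulr_ge0 // ltW.
    have x1 : mu * V j g f <= e1 / 2.
      have : mu * V j g f <= mu * (4 * sig) by rewrite ler_pM2l.
      by rewrite mulrCA musig; lra.
    have x2 : mu * V j g f <= 2^-1 by lra.
    have := expR_le1D2 x0 x2; rewrite -[(1 + e1) * mu * _]mulrA.
    by move: (mu * V j g f) x0 x1 x2 => x x0 x1 x2; nra.
  have S1 : mu * \sum_g \sum_f V j g f <= mu * (4 * rho).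
    by rewrite ler_pM2l //; apply: le_trans (sumV j) (crho j).
  have rs : (N * b)%:R * e1 / 8 <= mu * rho.
    by rewrite -mulrA -musig mulrC -mulrA ler_pM2l.
  move: S1 rs; set S := mu * _; set M := mu * rho; set B := (_ * b)%:R => S1 rs.
  rewrite (_ : _ - _ = (b%:R ^+ d)^-1 * (e1 * S - 8 * e1 * M)); last first.
    by rewrite /M; field; rewrite gt_eqF.
  rewrite (_ : - (_ / _) = (b%:R ^+ d)^-1 * (- (e1 ^+ 2 * B / 2))); last first.
    by field; rewrite gt_eqF.
  rewrite ler_pM2l ?invr_gt0 // -subr_ge0.
  have h1 : 0 <= e1 * (4 * M - S).
    by apply: mulr_ge0; [exact: ltW|move: S1; rewrite /M; lra].
  have h2 : 0 <= e1 * (M - B * e1 / 8) by rewrite mulr_ge0 ?subr_ge0 // ltW.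
  by lra.
exists F => a v r' a6 v1 hr'.
have [hit|nohit] := pselect (exists g t, chord_set (a - subcell rho gam g (F g)) v r' t);
    last first.
  rewrite big1 => [|g _]; last by apply: chord_eq0 => t ht; apply: nohit; exists g, t.
  apply: mulr_ge0; last exact: chord_ge0.
  apply: divr_ge0; last exact: ltW.
  by apply: addr_ge0 => //; apply: divr_ge0; [apply: mulr_ge0 => //|]; exact: ltW.
have {hit} hit : 2 * gam * rho <= chord a v ((1 + gam) * rho).
  case: hit => g [t ht].
  apply: le_trans (_ : 2 * ((1 + gam) * rho - rho) <= _); first by lra.
  apply: (@chord_ge _ _ _ _ rho _ t) => //; last by nra.
  move: ht; rewrite /chord_set /= => ht.
  have -> : a + t *: v = (a - subcell rho gam g (F g) + t *: v) + subcell rho gam g (F g).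
    by rewrite addrAC subrK.
  apply: le_trans (ler_normD _ _) _.
  apply: le_trans (subcell_norm N0 b0 rho0 gam0 gam1 g (F g)).
  rewrite addrC lerD2l; apply: le_trans ht _; apply: le_trans hr' _.
  by rewrite -[leRHS]mul1r ler_pM2r //; lra.
pose j := line_key K mesh (a, v).
have vl : valid (a, v) by [].
have [a6' v1'] := rep_valid j.
have [/= ha hv] := line_key_close (l' := (a, v)) mesh0 meshK a6' v1' a6 v1 (rep_key _ vl).
have ha' : `|a - (rep j).1| <= mesh by rewrite distrC.
have hv' : `|v - (rep j).2| <= mesh by rewrite distrC.
have gsig : 0 < gam * sig by rewrite mulr_gt0.
have step1 g : chord (a - subcell rho gam g (F g)) v r' <= V j g (F g).
  apply: chord_mono => // t ht.
  have hT : `|a - subcell rho gam g (F g)| + r' <= 8.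
    have := ler_normB a (subcell rho gam g (F g)).
    have := subcell_norm N0 b0 rho0 gam0 gam1 g (F g); rewrite -/sig.
    have : r' <= sig by apply: le_trans hr' _; rewrite -[leRHS]mul1r ler_pM2r //; lra.
    lra.
  have := chord_set_perturb v1 hT ha' hv' ht; rewrite /chord_set /= => H.
  by apply: le_trans H _; rewrite /s /mesh; move: hr'; rewrite !mulrBl !mul1r; lra.
have step2 : chord (rep j).1 (rep j).2 rho <= chord a v ((1 + gam) * rho).
  apply: chord_mono => // t ht.
  have hT : `|(rep j).1 - 0| + rho <= 8 by rewrite subr0; lra.
  rewrite -[(rep j).1]subr0 in ht.
  have := chord_set_perturb v1' hT ha hv ht; rewrite /chord_set /= subr0 => H.
  apply: le_trans H _.
  have : gam * sig <= gam * rho by rewrite ler_pM2l.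
  by rewrite /mesh; lra.
apply: le_trans (_ : \sum_g V j g (F g) <= _); first exact: ler_sum.
have := hF j; rewrite -mulr_sumr; have := sumV j.
set SS := \sum_g \sum_f _ => hSS.
have -> : (b%:R ^+ d)^-1 * (mu * SS) + 8 * e1 * mu * rho / b%:R ^+ d =
    mu * ((b%:R ^+ d)^-1 * (SS + 8 * e1 * rho)) by field; rewrite gt_eqF.
rewrite ltr_pM2l // => /ltW h; apply: le_trans h _.
have -> : (1 + 4 * e1 / gam) / b%:R ^+ d * chord a v ((1 + gam) * rho) =
   (b%:R ^+ d)^-1 * (chord a v ((1 + gam) * rho) +
   gam^-1 * (4 * e1 * chord a v ((1 + gam) * rho))).
  by field; rewrite !gt_eqF.
rewrite ler_pM2l ?invr_gt0 //; apply: lerD; first by apply: le_trans hSS step2.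
rewrite ler_pdivlMl //.
apply: (@le_trans _ _ (4 * e1 * (2 * gam * rho))); first lra.
by rewrite ler_pM2l // mulr_gt0.
Qed.

(** * Euclidean against sup norm, and the offsets kept at one step *)

Lemma normr_le_enorm (R : realType) (d : nat) (x : 'rV[R]_d) : `|x| <= enorm x.
Proof.
apply/rV_norm_leP => [|i]; first exact: sqrtr_ge0.
rewrite -sqrtr_sqr ler_wsqrtr // (bigD1 i) //= lerDl.
by apply: sumr_ge0 => j _; exact: sqr_ge0.
Qed.

Lemma enorm_le (R : realType) (d : nat) (x : 'rV[R]_d) : enorm x <= d%:R * `|x|.
Proof.
have h : 0 <= d%:R * `|x| by rewrite mulr_ge0.
rewrite -[leRHS](ger0_norm h) -sqrtr_sqr ler_wsqrtr //.
apply: le_trans (_ : \sum_(i < d) `|x| ^+ 2 <= _).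
  apply: ler_sum => i _; rewrite -real_normK ?num_real //.
  by rewrite lerXn2r ?nnegrE // rV_coord_le.
rewrite sumr_const card_ord -[leLHS]mulr_natl exprMn ler_wpM2r ?sqr_ge0 //.
by rewrite -natrX ler_nat; case: (d) => // n; rewrite leq_pmulr.
Qed.

Lemma tube_sup_tube (R : realType) (d : nat) (w : R) (T : set 'rV[R]_d) :
  tube w T -> exists (a v : 'rV[R]_d), `|v| = 1 /\
    T `<=` \bigcup_(t in [set: R]) ball (a + t *: v) w.
Proof.
move=> [w0 [_ [[p [v [v0 ->]]] ->]]].
have nv : `|v| != 0 by rewrite normr_eq0.
exists p, (`|v|^-1 *: v); split; first by rewrite normrZ normfV normr_id mulVf.
move=> x [_ [t _ <-] hx]; exists (t * `|v|) => //.
rewrite -ball_normE /= distrC scalerA mulfK //.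
exact: le_lt_trans (normr_le_enorm _) hx.
Qed.

Lemma one_step_offsets (R : realType) (d N b K : nat) (rho gam e1 r' : R) :
  let sig := (1 - gam) * rho / (N * b)%:R in
  (0 < N)%N -> (0 < b)%N -> 0 < rho -> rho <= 1 -> 0 < gam -> gam <= 2^-1 ->
  0 < e1 -> e1 <= 1 -> 432 < K.+1%:R * (gam * sig) ->
  K.+1%:R ^+ (2 * d) * expR (- (e1 ^+ 2 * (N * b)%:R / (2 * b%:R ^+ d))) < 1 ->
  r' <= (1 - gam / 2) * sig ->
  exists C : seq 'rV[R]_d,
    [/\ size C = (N ^ d)%N,
        forall x, x \in C -> `|x| + sig <= rho,
        forall x y, x \in C -> y \in C -> x != y ->
          2 * gam * (rho / N%:R) <= `|x - y| &
        forall a v, `|a| <= 6 -> `|v| = 1 ->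
          \sum_(x <- C) chord (a - x) v r' <=
          (1 + 4 * e1 / gam) / b%:R ^+ d * chord a v ((1 + gam) * rho)].
Proof.
move=> sig N0 b0 rho0 rho1 gam0 gam1 e0 e11 hK hprob hr'.
have [F hF] := one_step N0 b0 rho0 rho1 gam0 gam1 e0 e11 hK hprob.
exists [seq subcell rho gam g (F g) | g <- enum {: {ffun 'I_d -> 'I_N}}]; split.
- by rewrite size_map -cardE card_ffun !card_ord.
- by move=> x /mapP[g _ ->]; exact: subcell_norm.
- move=> x y /mapP[g _ ->] /mapP[g' _ ->] xy.
  have gg : g != g' by apply: contraNneq xy => ->.
  apply: le_trans (subcell_block_sep N0 b0 rho0 gam1 (F g) (F g') gg).
  rewrite lerDl mulr_ge0 // divr_ge0 // mulr_ge0 //; last exact: ltW.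
  by lra.
- move=> a v a6 v1; rewrite big_map big_enum /=; exact: hF.
Qed.

(** * The iterated construction and its tube estimate *)

Section Centers.
Variables (R : realType) (d' : nat).
Let d := d'.+1.
Variables (N b : nat -> nat) (gam eps : nat -> R).
Variable offs : nat -> seq 'rV[R]_d.

(** One factor [1 - gam] is the margin that separates blocks. The other shrinks the subcell itself,
    which makes room for rounding lines and for the enlargement [1 + gam] at the next level. *)
Fixpoint cell_rad (k : nat) : R :=
  if k is k'.+1 then (1 - gam k') ^+ 2 * cell_rad k' / (N k' * b k')%:R else 1.

Let sig k : R := (1 - gam k) * cell_rad k / (N k * b k)%:R.

(** All cubes of a level receive the same offsets: a selection good for all lines at once is good
    for all translates. *)
Fixpoint centers (k : nat) : seq 'rV[R]_d :=
  if k is k'.+1 then [seq z + x | z <- centers k', x <- offs k'] else [:: 0].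

Definition level (k : nat) : set 'rV[R]_d :=
  [set x | exists2 z, z \in centers k & `|x - z| <= cell_rad k].

Definition limit_set : set 'rV[R]_d := [set x | forall k, level k x].

Hypotheses (N0 : forall k, (0 < N k)%N) (b0 : forall k, (0 < b k)%N).
Hypotheses (gam0 : forall k, 0 < gam k) (gam1 : forall k, gam k <= 2^-1).
Hypothesis gamb : forall k, 2 <= gam k * (b k)%:R.
Hypothesis eps0 : forall k, 0 <= eps k.
Hypothesis offs_size : forall k, size (offs k) = (N k ^ d)%N.
Hypothesis offs_norm : forall k x, x \in offs k -> `|x| + sig k <= cell_rad k.
Hypothesis offs_sep : forall k x y, x \in offs k -> y \in offs k -> x != y ->
  2 * gam k * (cell_rad k / (N k)%:R) <= `|x - y|.
(** Both sides have the enlarged half-width [(1 + gam) * cell_rad], at consecutive levels, so that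
    the estimate can be iterated. *)
Hypothesis offs_chord : forall k a v, `|a| <= 6 -> `|v| = 1 ->
  \sum_(x <- offs k) chord (a - x) v ((1 + gam k.+1) * cell_rad k.+1) <=
  (1 + eps k) / (b k)%:R ^+ d * chord a v ((1 + gam k) * cell_rad k).
Hypothesis eps_prod : forall k, \prod_(i < k) (1 + eps i) <= 2.
Hypothesis rad_ge : forall k, 1 <= 2 * cell_rad k * \prod_(i < k) (N i * b i)%:R.

Lemma Nb_gt0 k : 0 < (N k * b k)%:R :> R.
Proof. by rewrite ltr0n muln_gt0 N0 b0. Qed.

Lemma gamC_gt0 k : 0 < 1 - gam k.
Proof. by have := gam1 k; lra. Qed.

Lemma rad_gt0 k : 0 < cell_rad k.
Proof.
elim: k => //= k IH; apply: divr_gt0; last exact: Nb_gt0.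
by apply: mulr_gt0 => //; apply: exprn_gt0; exact: gamC_gt0.
Qed.

Lemma sig_gt0 k : 0 < sig k.
Proof.
apply: divr_gt0; last exact: Nb_gt0.
by apply: mulr_gt0; [exact: gamC_gt0|exact: rad_gt0].
Qed.

Lemma radS k : cell_rad k.+1 = (1 - gam k) * sig k.
Proof. by rewrite /= /sig expr2 !mulrA. Qed.

Lemma radS_lt_sig k : cell_rad k.+1 < sig k.
Proof.
rewrite radS -[ltRHS]mul1r ltr_pM2r ?sig_gt0 //; have := gam0 k; lra.
Qed.

Lemma radS_Nb k : cell_rad k.+1 * (N k * b k)%:R <= cell_rad k.
Proof.
have h : (1 - gam k) ^+ 2 <= 1.
  by have := gamC_gt0 k; have := gam0 k; nra.
by rewrite /= divfK ?gt_eqF ?Nb_gt0 // ler_piMl // ltW // rad_gt0.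
Qed.

Lemma radS_le k : cell_rad k.+1 <= cell_rad k.
Proof.
apply: le_trans (radS_Nb k); rewrite ler_peMr ?(ltW (rad_gt0 _)) //.
by rewrite ler1n muln_gt0 N0 b0.
Qed.

Lemma rad_le1 k : cell_rad k <= 1.
Proof. by elim: k => // k IH; apply: le_trans (radS_le k) IH. Qed.

Lemma rad_mono k l : (k <= l)%N -> cell_rad l <= cell_rad k.
Proof.
move/subnK <-; elim: (l - k)%N => // n IH; rewrite addSn.
exact: le_trans (radS_le _) IH.
Qed.

Lemma size_centers k : size (centers k) = \prod_(i < k) (N i ^ d)%N.
Proof.
elim: k => [|k IH]; first by rewrite big_ord0.
by rewrite /= size_allpairs IH offs_size big_ord_recr.
Qed.

Lemma centers_norm k z : z \in centers k -> `|z| + cell_rad k <= 1.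
Proof.
elim: k z => [|k IH] z; first by rewrite inE => /eqP ->; rewrite normr0 add0r.
move=> /allpairsP[[y x] /= [hy hx ->]].
have := IH _ hy; have := offs_norm hx; have := radS_lt_sig k.
by have := ler_normD y x; rewrite -/(cell_rad k.+1); lra.
Qed.

Lemma levelS k : level k.+1 `<=` level k.
Proof.
move=> x [z /allpairsP[[y u] /= [hy hu ->]] hz]; exists y => //.
have -> : x - y = (x - (y + u)) + u by rewrite opprD addrA addrNK.
have := offs_norm hu; have := ler_normD (x - (y + u)) u; have := radS_lt_sig k.
by rewrite -/(cell_rad k.+1) in hz *; lra.
Qed.

Lemma level_mono k l : (k <= l)%N -> level l `<=` level k.
Proof.
move/subnK <-; elim: (l - k)%N => // n IH; rewrite addSn.
exact: subset_trans (@levelS _) IH.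
Qed.

Let sep k : R := 2 * gam k * (cell_rad k / (N k)%:R).

Lemma radS_sep k : cell_rad k.+1 * (b k)%:R * gam k * 2 <= sep k.
Proof.
have Nk : 0 < (N k)%:R :> R by rewrite ltr0n.
have : cell_rad k.+1 * (b k)%:R <= cell_rad k / (N k)%:R.
  rewrite ler_pdivlMr // -mulrA; apply: le_trans (radS_Nb k).
  by rewrite natrM [(b k)%:R * _]mulrC.
move=> h; have := ler_wpM2l (ltW (gam0 k)) h; rewrite /sep; lra.
Qed.

Lemma sep_ge k : 4 * cell_rad k.+1 <= sep k.
Proof.
apply: le_trans (radS_sep k).
by have := ler_wpM2l (ltW (rad_gt0 k.+1)) (gamb k); lra.
Qed.

(** With a common parent this is the separation of the offsets. Otherwise the parents are at least
    [4 * cell_rad] apart by the previous level, and the two offsets take away less than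
    [2 * cell_rad]. *)
Lemma centers_sep k z z' : z \in centers k.+1 -> z' \in centers k.+1 -> z != z' ->
  sep k <= `|z - z'|.
Proof.
have Nk j : 1 <= (N j)%:R :> R by rewrite ler1n.
have seprad j : sep j <= cell_rad j.
  have h : cell_rad j / (N j)%:R <= cell_rad j.
    rewrite ler_pdivrMr; last by apply: lt_le_trans (Nk j).
    by rewrite ler_peMr // ltW // rad_gt0.
  have h2 : 0 < cell_rad j / (N j)%:R.
    by rewrite divr_gt0 ?rad_gt0 // (lt_le_trans ltr01 (Nk j)).
  rewrite /sep; have := gam1 j; have := gam0 j; nra.
have step j : (forall y y', y \in centers j -> y' \in centers j -> y != y' ->
    4 * cell_rad j <= `|y - y'|) -> forall x x', x \in centers j.+1 ->
    x' \in centers j.+1 -> x != x' -> sep j <= `|x - x'|.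
  move=> IH x x' /allpairsP[[y u] /= [hy hu ->]] /allpairsP[[y' u'] /= [hy' hu' ->]].
  have [<-|yy _] := eqVneq y y'.
    rewrite (inj_eq (addrI y)) => uu.
    by rewrite opprD addrACA subrr add0r; exact: offs_sep.
  have := IH _ _ hy hy' yy; have := offs_norm hu; have := offs_norm hu'.
  have := sig_gt0 j; have := seprad j; have := rad_gt0 j.
  have -> : y + u - (y' + u') = (y - y') - (u' - u).
    by rewrite opprD addrACA opprB.
  have := lerB_dist (y - y') (u' - u); have := ler_normB u' u; lra.
elim: k z z' => [|k IH]; apply: step.
  by move=> y y'; rewrite !inE => /eqP -> /eqP ->; rewrite eqxx.
by move=> y y' hy hy' yy; apply: le_trans (sep_ge k) (IH _ _ hy hy' yy).
Qed.

(** Each centre has norm at most 1, so [a - z] stays within the bound 6 under which [offs_chord]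
    applies. *)
Lemma centers_chord k a v : `|a| <= 5 -> `|v| = 1 ->
  \sum_(z <- centers k) chord (a - z) v ((1 + gam k) * cell_rad k) <=
  \prod_(i < k) ((1 + eps i) / (b i)%:R ^+ d) * chord a v (1 + gam 0).
Proof.
move=> a5 v1; elim: k => [|k IH].
  by rewrite big_ord0 mul1r big_seq1 subr0 mulr1.
rewrite [centers _]/= big_allpairs_dep /=.
have c0 : 0 <= (1 + eps k) / (b k)%:R ^+ d by rewrite divr_ge0 ?addr_ge0 // exprn_ge0.
rewrite big_ord_recr [leRHS]mulrAC; apply: le_trans (ler_wpM2r c0 IH).
rewrite mulr_suml big_seq [leRHS]big_seq; apply: ler_sum => z hz.
under eq_bigr do rewrite opprD addrA.
rewrite [leRHS]mulrC; apply: offs_chord => //.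
apply: le_trans (ler_normB _ _) _; have := centers_norm hz; have := rad_gt0 k; lra.
Qed.

(** Since [b^-d = N^d / (N * b)^d], the fraction kept along a line is the number of cubes times
    [cell_rad ^ d], up to the factor 2 of [eps_prod] and the factor [2 ^ d] of [rad_ge]. *)
Lemma prod_eps_le k :
  \prod_(i < k) ((1 + eps i) / (b i)%:R ^+ d) <=
  2 * 2 ^+ d * cell_rad k ^+ d * (size (centers k))%:R.
Proof.
have b1 i : 0 < (b i)%:R :> R by rewrite ltr0n.
rewrite size_centers natr_prod big_split /= -mulrA -mulrA; apply: ler_pM.
- by apply: prodr_ge0 => i _; rewrite addr_ge0.
- by apply: prodr_ge0 => i _; rewrite invr_ge0 exprn_ge0.
- exact: eps_prod.
have -> : \prod_(i < k) ((N i ^ d)%:R : R) =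
    (\prod_(i < k) (N i * b i)%:R) ^+ d * \prod_(i < k) (b i)%:R ^- d.
  rewrite -prodrXl -big_split /=; apply: eq_bigr => i _.
  by rewrite natrX natrM exprMn mulfK // expf_neq0 // gt_eqF.
rewrite 2!mulrA -!exprMn -[leLHS]mul1r ler_wpM2r //.
  by apply: prodr_ge0 => i _; rewrite invr_ge0 exprn_ge0.
by rewrite exprn_ege1 // rad_ge.
Qed.

(* Translating the axis of the tube by a grid of mesh [cell_rad k / 2] transversal
   to it, every centre in the tube is seen by one of the translated lines. *)
Lemma tube_count k (a0 v : 'rV[R]_d) w : `|v| = 1 -> cell_rad k <= w -> w <= 1 ->
  (count (fun z => `[< exists t, `|a0 + t *: v - z| <= w >]) (centers k))%:R <=
  12 * 2 ^+ d * 9 ^+ d' * w ^+ d' * (size (centers k))%:R.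
Proof.
move=> v1 rw w1; set P := (fun z => _).
have w0 : 0 < w by apply: lt_le_trans (rad_gt0 k) rw.
have w0' := ltW w0; have r0' := ltW (rad_gt0 k).
have [/hasP[z0 hz0 /asboolP[t0 ht0]]|nh] := boolP (has P (centers k)); last first.
  have -> : count P (centers k) = 0%N.
    by apply/eqP; rewrite -leqn0 leqNgt -has_count.
  by rewrite !mulr_ge0 ?exprn_ge0.
(* The base point is slid along the axis to within [w <= 1] of a centre, hence has norm at most 2;
   with the shifts [u f] it obeys the bound 5 of [centers_chord]. *)
pose a := a0 + t0 *: v.
have a2 : `|a| <= 2.
  have -> : a = (a - z0) + z0 by rewrite subrK.
  apply: le_trans (ler_normD _ _) _; have := centers_norm hz0; have := rad_gt0 k.
  by rewrite /a; lra.
have aE : a = a0 + t0 *: v by [].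
clearbody a.
(* The shifts will fix a coordinate where [|v|] is attained, which makes them transversal to the
   axis. *)
have [i0 hi0] : exists i, `|v ord0 i| = 1.
  by have [|i hi] := rV_norm_coord (x := v); [rewrite v1|exists i; rewrite hi].
have vi0 : v ord0 i0 != 0 by rewrite -normr_eq0 hi0 oner_neq0.
pose h := cell_rad k / 2; have h0 : 0 < h by rewrite divr_gt0 // rad_gt0.
pose K := Num.truncn (4 * w / h).
have wh0 : 0 <= 4 * w / h by rewrite divr_ge0 ?mulr_ge0 ?(ltW w0) ?(ltW h0).
have hK : h * K%:R <= 4 * w.
  by rewrite mulrC -ler_pdivlMr // truncn_le.
pose u (f : {ffun 'I_d' -> 'I_K.+1}) : 'rV[R]_d :=
  \row_i (if unlift i0 i is Some j then h * (f j)%:R - 2 * w else 0).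
have hu f : `|u f| <= 2 * w.
  apply/rV_norm_leP => [|i]; first by lra.
  rewrite mxE; case: unliftP => [j _|_]; last by rewrite normr0; lra.
  have : h * (f j)%:R <= h * K%:R.
    by rewrite ler_pM2l // ler_nat -ltnS ltn_ord.
  have : 0 <= h * (f j)%:R by rewrite mulr_ge0 // ltW.
  by rewrite ler_norml; lra.
have hz z : P z -> exists f, cell_rad k <= chord (a + u f - z) v ((1 + gam k) * cell_rad k).
  move=> /asboolP[t1' ht1']; pose t1 := t1' - t0.
  have ht1 : `|a + t1 *: v - z| <= w.
    rewrite (_ : a + t1 *: v = a0 + t1' *: v) //.
    by rewrite aE /t1 scalerBl -addrA [t0 *: v + _]addrC subrK.
  (* At [t] the axis has the same coordinate [i0] as [z], so the displacement [y] lies in the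
     hyperplane of the shifts. *)
  pose t := (z - a) ord0 i0 / v ord0 i0.
  have htt : `|t1 - t| <= w.
    rewrite -[leLHS]mulr1 -hi0 -normrM mulrBl /t divfK //.
    by apply: le_trans ht1; have := rV_coord_le (a + t1 *: v - z) i0;
       rewrite !mxE opprB addrA [_ + t1 * _]addrC addrAC.
  pose y := z - a - t *: v.
  have y2 : `|y| <= 2 * w.
    have -> : y = (t1 - t) *: v - (a + t1 *: v - z).
      by rewrite /y scalerBl opprB [RHS]addrC opprD !addrA subrK.
    apply: le_trans (ler_normB _ _) _; rewrite normrZ v1 mulr1; lra.
  have yi0 : y ord0 i0 = 0 by rewrite !mxE /t !mxE divfK // subrr.
  have yh j : 0 <= (y ord0 (lift i0 j) + 2 * w) / h.
    have := le_trans (rV_coord_le y (lift i0 j)) y2; rewrite ler_norml => /andP[? ?].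
    by rewrite divr_ge0 ?(ltW h0) //; lra.
  have yK j : (Num.truncn ((y ord0 (lift i0 j) + 2 * w) / h) < K.+1)%N.
    rewrite ltnS le_truncn // ler_pM2r ?invr_gt0 //.
    by have := le_trans (rV_coord_le y (lift i0 j)) y2; rewrite ler_norml; lra.
  exists [ffun j => Ordinal (yK j)].
  set f := [ffun j => _].
  have uy : `|u f - y| <= h.
    apply/rV_norm_leP => [|i]; first exact: ltW.
    rewrite mxE [(u f) _ _]mxE; case: unliftP => [j ->|->]; last first.
      by rewrite mxE yi0 subr0 normr0 ltW.
    rewrite ffunE /= [(- y) _ _]mxE; have /andP[] := truncn_itv (yh j).
    set T := Num.truncn _; rewrite ler_pdivlMr // ltr_pdivrMr // -natr1 mulrDl mul1r.
    by rewrite ler_norml mulrC => ? ?; lra.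
  (* The shifted line passes within [h = cell_rad k / 2] of [z], so its chord is at least
     [2 * (cell_rad k - h)]. *)
  apply: le_trans (_ : 2 * ((1 + gam k) * cell_rad k - h) <= _).
    have : 0 <= gam k * cell_rad k by rewrite mulr_ge0 ?(ltW (gam0 _)) .
    by rewrite /h; lra.
  have gr : 0 <= gam k * cell_rad k by rewrite mulr_ge0 ?(ltW (gam0 _)) .
  apply: (@chord_ge _ _ _ _ _ _ t) => //; last first.
    by rewrite /h; have := rad_gt0 k; lra.
  rewrite /chord_set /= (_ : _ + _ = u f - y) //.
  by rewrite /y !opprB [a + u f]addrC -!addrA; congr (_ + _); rewrite addrA addrC.
have main : cell_rad k * (count P (centers k))%:R <=
    \sum_f \sum_(z <- centers k) chord (a + u f - z) v ((1 + gam k) * cell_rad k).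
  rewrite exchange_big /= -sum1_count natr_sum mulr_sumr [leRHS](bigID P) /=.
  rewrite -[leLHS]addr0; apply: lerD; last first.
    by apply: sumr_ge0 => z _; apply: sumr_ge0 => f _; exact: chord_ge0.
  apply: ler_sum => z /hz [f hf]; rewrite mulr1 (bigD1 f) //= -[leLHS]addr0.
  by apply: lerD => //; apply: sumr_ge0 => g _; exact: chord_ge0.
(* The factor 6 bounds [4 * (1 + gam 0)]. *)
have bound f : \sum_(z <- centers k) chord (a + u f - z) v ((1 + gam k) * cell_rad k) <=
    2 * 2 ^+ d * cell_rad k ^+ d * (size (centers k))%:R * 6.
  apply: le_trans (centers_chord k _ v1) _.
    by apply: le_trans (ler_normD _ _) _; have := hu f; lra.
  apply: ler_pM; [|exact: chord_ge0|exact: prod_eps_le|].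
    by apply: prodr_ge0 => i _; rewrite divr_ge0 ?addr_ge0 // exprn_ge0.
  have g0 := gam0 0; have g1 := gam1 0; apply: le_trans (chord_le _ v1 _) _; lra.
(* [K] is at most [4 * w / h = 8 * w / cell_rad k], and the extra 1 is at most [w / cell_rad k]. *)
have K9 : (K.+1)%:R * cell_rad k <= 9 * w.
  by rewrite -natr1 mulrDl mul1r; move: hK; rewrite /h; lra.
rewrite -(ler_pM2l (rad_gt0 k)); apply: le_trans main _.
apply: (@le_trans _ _ (K.+1%:R ^+ d' *
    (2 * 2 ^+ d * cell_rad k ^+ d * (size (centers k))%:R * 6))).
  have -> : K.+1%:R ^+ d' = #|{: {ffun 'I_d' -> 'I_K.+1}}|%:R :> R.
    by rewrite card_ffun !card_ord natrX.
  by rewrite [leRHS]mulr_natl -[leRHS]sumr_const; apply: ler_sum => f _; exact: bound.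
have -> : K.+1%:R ^+ d' * (2 * 2 ^+ d * cell_rad k ^+ d * (size (centers k))%:R * 6) =
   (12 * 2 ^+ d * (size (centers k))%:R * cell_rad k) * ((K.+1%:R * cell_rad k) ^+ d').
  by rewrite exprMn (exprS (cell_rad k)); ring.
have -> : cell_rad k * (12 * 2 ^+ d * 9 ^+ d' * w ^+ d' * (size (centers k))%:R) =
   (12 * 2 ^+ d * (size (centers k))%:R * cell_rad k) * ((9 * w) ^+ d').
  by rewrite exprMn; ring.
apply: ler_wpM2l.
  by rewrite !mulr_ge0 ?exprn_ge0.
rewrite lerXn2r ?nnegrE //; by rewrite mulr_ge0.
Qed.

Lemma rad_le_geo k : cell_rad k <= 2 ^- k.
Proof.
elim: k => [|k IH]; first by rewrite expr0 invr1.
have b2 : 2 <= (N k * b k)%:R :> R.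
  have N1 : 1 <= (N k)%:R :> R by rewrite ler1n.
  have := gamb k; have := gam1 k; have := gam0 k; rewrite natrM; nra.
have := radS_Nb k; have := rad_gt0 k.+1; rewrite exprS invfM.
have : cell_rad k.+1 * 2 <= cell_rad k.+1 * (N k * b k)%:R by rewrite ler_pM2l ?rad_gt0.
lra.
Qed.

Lemma rad_small (e : R) : 0 < e -> exists k, forall l, (k <= l)%N -> cell_rad l <= e.
Proof.
move=> e0; pose k := (Num.truncn e^-1).+1; exists k => l kl.
apply: le_trans (rad_mono kl) _; apply: le_trans (rad_le_geo k) _.
rewrite invf_ple ?posrE ?exprn_gt0 //; apply: ltW; apply: lt_le_trans (truncnS_gt _) _.
by rewrite -/k -natrX ler_nat ltnW // ltn_expl.
Qed.

Lemma level_closed k : closed (level k).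
Proof.
have -> : level k = \bigcup_(z in [set` centers k]) closed_ball z (cell_rad k).
  apply/seteqP; split => x.
    move=> [z hz xz]; exists z => //.
    by rewrite closed_ballE ?rad_gt0 // /closed_ball_ /= distrC.
  by move=> [z hz]; rewrite closed_ballE ?rad_gt0 // /closed_ball_ /= distrC => ?; exists z.
apply: closed_bigcup => [|z _]; first exact: finite_seq.
exact: closed_ball_closed.
Qed.

Lemma level0_compact : compact (level 0).
Proof.
apply: bounded_closed_compact; last exact: level_closed.
exists 1; split=> [|M M1 x [z]]; first exact: num_real.
rewrite inE => /eqP -> /=; rewrite subr0 => x1; apply: le_trans x1 (ltW M1).
Qed.

Let C : R := 12 * 2 ^+ d * 9 ^+ d'.

Lemma tube_count_ball k (a v : 'rV[R]_d) w : `|v| = 1 -> cell_rad k <= w ->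
  (count (fun z => `[< (\bigcup_(t in [set: R]) ball (a + t *: v) w) z >])
     (centers k))%:R <= C * w ^+ d' * (size (centers k))%:R.
Proof.
move=> v1 rw; have [w1|/ltW w1] := leP w 1.
  apply: le_trans (@tube_count k a v w v1 rw w1); rewrite ler_nat; apply: sub_count => z.
  move=> /asboolP[t _]; rewrite -ball_normE /= => h; apply/asboolP; exists t.
  exact: ltW.
apply: le_trans (_ : (size (centers k))%:R <= _); first by rewrite ler_nat count_size.
rewrite ler_peMl // mulr_ege1 ?exprn_ege1 // /C.
by rewrite !mulr_ege1 ?exprn_ege1 ?ler1n.
Qed.

Lemma limit_set_tubes (J : set nat) (T : nat -> set 'rV[R]_d) (w : nat -> R) :
  (forall j, J j -> tube (w j) (T j)) -> limit_set `<=` \bigcup_(j in J) T j ->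
  (C^-1%:E <= \esum_(j in J) (w j ^+ d')%:E)%E.
Proof.
move=> hT hcov.
have C0 : 0 < C by rewrite !mulr_gt0 ?exprn_gt0.
have hS j : exists av : 'rV[R]_d * 'rV[R]_d, J j -> `|av.2| = 1 /\
    T j `<=` \bigcup_(t in [set: R]) ball (av.1 + t *: av.2) (w j).
  have [Jj|nJ] := pselect (J j); last by exists (0, 0).
  by have [a [v h]] := tube_sup_tube (hT _ Jj); exists (a, v).
pose av j := sval (cid (hS j)).
have hav j : J j -> `|(av j).2| = 1 /\
    T j `<=` \bigcup_(t in [set: R]) ball ((av j).1 + t *: (av j).2) (w j).
  by rewrite /av; case: cid.
pose S j : set 'rV[R]_d :=
  \bigcup_(t in [set: R]) ball ((av j).1 + t *: (av j).2) (w j).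
(* Pairing tube [j] with the complement of level [j] gives an open cover of level 0. In a finite
   subcover the complements all miss level [n], for [n] the largest index, so the tubes alone cover
   that level. *)
pose U j := [set x | J j /\ S j x] `|` ~` level j.
have Uopen j : [set: nat] j -> open (U j).
  move=> _; apply: openU; last by apply: closed_openC; exact: level_closed.
  have [Jj|nJ] := pselect (J j).
    rewrite (_ : [set x | _] = S j); last first.
      by apply/seteqP; split => [x []|x ?].
    by apply: bigcup_open => t _; exact: ball_open.
  rewrite (_ : [set x | _] = set0); first exact: open0.
  by apply/seteqP; split => // x [].
have := level0_compact; rewrite compact_cover => /(_ nat [set: nat] U Uopen) [].
  move=> x x0; have [xA|] := pselect (limit_set x).
    have [j Jj Tx] := hcov _ xA; exists j => //; left; split => //.
    by have [_] := hav _ Jj; apply.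
  by move=> /existsNP[k nk]; exists k => //; right.
move=> D _ covD.
pose s := [seq j <- finmap.enum_fset D | `[< J j >]].
have us : uniq s by rewrite filter_uniq // finmap.fset_uniq.
pose n := \max_(j <- finmap.enum_fset D) j.
have lev_n : level n `<=` \bigcup_(j in [set` s]) S j.
  move=> x xn; have [j jD] := covD _ (level_mono (leq0n n) xn).
  move=> [[Jj Sx]|[]]; last first.
    by apply: (level_mono _ xn); rewrite /n (big_rem j) //= leq_maxl.
  by exists j => //=; rewrite mem_filter jD andbT; apply/asboolP.
(* Only finitely many tubes remain, so some level is finer than all their widths, as the count of
   centres requires. *)
have [k0 hk0] : exists k0, forall k j, (k0 <= k)%N -> j \in s -> cell_rad k <= w j.
  have : {in s, forall j, J j} by move=> j; rewrite mem_filter => /andP[/asboolP].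
  elim: (s) => [|j t IH] sJ; first by exists 0.
  have [|k1 h1] := IH; first by move=> i it; apply: sJ; rewrite inE it orbT.
  have [|k2 h2] := @rad_small (w j).
    by have [] := hT j (sJ _ (mem_head _ _)).
  exists (maxn k1 k2) => k i; rewrite geq_max inE => /andP[kk1 kk2] /orP[/eqP ->|it].
    exact: h2.
  exact: h1.
pose k := maxn n k0.
have sz0 : 0 < (size (centers k))%:R :> R.
  by rewrite ltr0n size_centers prodn_gt0 // => i; rewrite expn_gt0 N0.
have cnt : (size (centers k))%:R <=
    \sum_(j <- s) (count (fun z => `[< S j z >]) (centers k))%:R :> R.
  rewrite -natr_sum ler_nat; under eq_bigr do rewrite -sum1_count big_mkcond.
  rewrite exchange_big /= -sum1_size big_seq [leqRHS]big_seq; apply: leq_sum => z hz.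
  have [j /= js Sz] : (\bigcup_(j in [set` s]) S j) z.
    apply: lev_n; apply: (@level_mono n k (leq_maxl _ _)); exists z => //.
    by rewrite subrr normr0 ltW // rad_gt0.
  by rewrite (big_rem j) //= ifT ?leq_addr //; apply/asboolP.
apply: esum_ge; exists [set` s].
  by split; [exact: finite_seq|move=> j /=; rewrite mem_filter => /andP[/asboolP]].
rewrite -fsbig_seq // sumEFin lee_fin -[leLHS]mulr1 mulrC ler_pdivrMr //.
rewrite -(ler_pM2r sz0) mul1r; apply: le_trans cnt _; rewrite !mulr_suml.
rewrite big_seq [leRHS]big_seq; apply: ler_sum => j js.
rewrite [w j ^+ d' * _]mulrC; apply: tube_count_ball.
  by have [] := hav j; [move: js; rewrite mem_filter => /andP[/asboolP]|].
by apply: hk0 => //; exact: leq_maxr.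
Qed.

(** Points in different cubes of level [k.+1] are at least [sep k - 2 * cell_rad k.+1] apart, which
    is no less than [sep k / 2]. *)
Lemma limit_set_separated k x y : limit_set x -> limit_set y ->
  `|x - y| < sep k / 2 -> `|x - y| <= 2 * cell_rad k.+1.
Proof.
move=> /(_ k.+1)[z hz xz] /(_ k.+1)[z' hz' yz] xy.
have [zz|zz] := eqVneq z z'.
  have -> : x - y = (x - z) - (y - z) by rewrite opprB addrA subrK.
  by apply: le_trans (ler_normB _ _) _; rewrite {2}zz; lra.
have := centers_sep hz hz' zz; have := sep_ge k.
have : `|z - z'| <= `|x - y| + (`|x - z| + `|y - z'|).
  have -> : z - z' = (x - y) - ((x - z) - (y - z')).
    by rewrite opprB addrA [x - y + _]addrA subrK opprB [RHS]addrC addrA subrK.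
  by apply: le_trans (ler_normB _ _) _; rewrite lerD2l; exact: ler_normB.
lra.
Qed.

Definition cell k i : set 'rV[R]_d :=
  [set x | `|x - nth 0 (centers k) i| <= cell_rad k].

Lemma limit_set_cells k : limit_set `<=` \bigcup_(i in `I_(size (centers k))) cell k i.
Proof.
move=> x /(_ k)[z hz xz]; exists (index z (centers k)); first by rewrite /= index_mem.
by rewrite /cell /= nth_index.
Qed.

Lemma cell_diam k i x y : cell k i x -> cell k i y -> `|x - y| <= 2 * cell_rad k.
Proof.
rewrite /cell /=; set z := nth _ _ _ => xz yz.
have -> : x - y = (x - z) - (y - z) by rewrite opprB addrA subrK.
by apply: le_trans (ler_normB _ _) _; lra.
Qed.

End Centers.

(** * Hausdorff sums of covers and null sets *)

Section Diameter.
Variables (R : realType) (d : nat).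
Implicit Types (U V : set 'rV[R]_d).

Lemma diam_ge0 U x : U x -> (0 <= diam U)%E.
Proof.
move=> Ux; apply: ereal_sup_ubound; exists (x, x) => //=.
by rewrite subrr /enorm big1 ?sqrtr0 // => i _; rewrite mxE expr0n.
Qed.

Lemma enorm_le_diam U x y : U x -> U y -> ((enorm (x - y))%:E <= diam U)%E.
Proof. by move=> Ux Uy; apply: ereal_sup_ubound; exists (x, y). Qed.

Lemma diam_le_sup U (r : R) :
  (forall x y, U x -> U y -> `|x - y| <= r) -> (diam U <= (d%:R * r)%:E)%E.
Proof.
move=> h; apply: ge_ereal_sup => _ [[x y] /= [Ux Uy] <-]; rewrite lee_fin.
by apply: le_trans (enorm_le _) _; rewrite ler_wpM2l //; exact: h.
Qed.

Lemma hausdorff_gauge_ge0 s U : (0 <= hausdorff_gauge s U)%E.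
Proof. by rewrite /hausdorff_gauge; case: ifP => // _; exact: poweR_ge0. Qed.

Lemma hausdorff_gauge_le s U (r : R) : 0 <= s -> 0 <= r ->
  (diam U <= r%:E)%E -> (hausdorff_gauge s U <= (r `^ s)%:E)%E.
Proof.
move=> s0 r0 Ur; rewrite /hausdorff_gauge; case: ifPn => [_|/set0P[x Ux]].
  by rewrite lee_fin powR_ge0.
rewrite -poweR_EFin; apply: gt0_ler_poweR => //.
  by rewrite in_itv /= (diam_ge0 Ux) leey.
by rewrite in_itv /= lee_fin r0 leey.
Qed.

Lemma hausdorff_premeasure_ge0 s delta U :
  (0 <= hausdorff_premeasure s delta U)%E.
Proof.
apply: le_ereal_inf_tmp => _ [V _ <-]; apply: nneseries_ge0 => i _ _.
exact: hausdorff_gauge_ge0.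
Qed.

(** Vanishing measure stated through covers, the form that passes to countable unions. *)
Definition hausdorff_null (s : R) (B : set 'rV[R]_d) : Prop :=
  forall delta e : R, 0 < delta -> 0 < e -> exists V : (set 'rV[R]_d)^nat,
    [/\ forall i, (diam (V i) <= delta%:E)%E, B `<=` \bigcup_i V i &
     (\sum_(0 <= i <oo) hausdorff_gauge s (V i) <= e%:E)%E].

Lemma hausdorff_measure_eq0 s U :
  hausdorff_null s U -> hausdorff_measure s U = 0%E.
Proof.
move=> h; apply/eqP; rewrite eq_le; apply/andP; split.
  apply: ge_ereal_sup => _ [delta delta0 <-].
  apply/lee_addgt0Pr => e e0; rewrite add0e.
  have [V [dV UV hV]] := h _ _ delta0 e0; apply: le_trans hV.
  by apply: ereal_inf_lbound; exists V.
apply: le_trans (hausdorff_premeasure_ge0 s 1 U) _.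
by apply: ereal_sup_ubound; exists 1 => //=.
Qed.

Lemma hausdorff_measure_eq0_cover s U (e : R) : hausdorff_measure s U = 0%E ->
  0 < e -> exists V : (set 'rV[R]_d)^nat,
     [/\ forall i, (diam (V i) <= 1%:E)%E, U `<=` \bigcup_i V i &
     (\sum_(0 <= i <oo) hausdorff_gauge s (V i) <= e%:E)%E].
Proof.
move=> h e0; have : (hausdorff_premeasure s 1 U < e%:E)%E.
  apply: (@le_lt_trans _ _ 0%E); last by rewrite lte_fin.
  by rewrite -h; apply: ereal_sup_ubound; exists 1 => //=.
by move=> /ereal_inf_lt[_ [V [dV UV] <-] /ltW hV]; exists V.
Qed.

Lemma finite_cover_sum s (n : nat) (r : R) (V : nat -> set 'rV[R]_d) :
  0 <= s -> 0 <= r -> (forall i, (i < n)%N -> (diam (V i) <= r%:E)%E) ->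
  (\sum_(0 <= i <oo) hausdorff_gauge s (if (i < n)%N then V i else set0) <=
   (n%:R * r `^ s)%:E)%E.
Proof.
move=> s0 r0 hV; rewrite (@nneseries_split _ _ 0 n); last first.
  by move=> k _; exact: hausdorff_gauge_ge0.
rewrite eseries0 ?adde0; last first.
  by move=> i; rewrite add0n ltnNge => -> _; rewrite /hausdorff_gauge eqxx.
rewrite add0n big_mkord; apply: (@le_trans _ _ (\sum_(i < n) (r `^ s)%:E)%E).
  by apply: lee_sum => i _; rewrite ltn_ord; apply: hausdorff_gauge_le => //; exact: hV.
by rewrite sumEFin lee_fin sumr_const card_ord -[leLHS]mulr_natl.
Qed.

End Diameter.

Lemma powR_exprn_le (R : realType) (x s : R) (n : nat) : (0 < n)%N -> 0 <= x ->
  x <= 1 -> s <= n%:R -> x ^+ n <= x `^ s.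
Proof.
move=> n0; rewrite le_eqVlt => /orP[/eqP <- _ _|x0 x1 sn].
  by rewrite expr0n gtn_eqF // powR_ge0.
by rewrite -powR_mulrn ?(ltW x0) //; apply: ger_powR => //; rewrite x0.
Qed.

Lemma exprD_le (R : realType) (x y : R) (n : nat) : 0 <= x -> 0 <= y ->
  (x + y) ^+ n <= 2 ^+ n * (x ^+ n + y ^+ n).
Proof.
move=> x0 y0; wlog xy : x y x0 y0 / x <= y => [h|].
  by have [xy|/ltW xy] := leP x y; [exact: h|rewrite addrC [x ^+ n + _]addrC; exact: h].
apply: (@le_trans _ _ ((2 * y) ^+ n)).
  by rewrite lerXn2r ?nnegrE ?addr_ge0 ?mulr_ge0 //; lra.
by rewrite exprMn ler_wpM2l ?exprn_ge0 // lerDr exprn_ge0.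
Qed.

(** * Hausdorff and box dimension from a tube bound and explicit covers *)

Section Dimensions.
Variables (R : realType) (d' : nat).
Hypothesis d'0 : (0 < d')%N.
Let d := d'.+1.
Variables (A : set 'rV[R]_d) (c : R).
Hypothesis c0 : 0 < c.
Hypothesis tubes : forall (J : set nat) (T : nat -> set 'rV[R]_d) (w : nat -> R),
  (forall j, J j -> tube (w j) (T j)) -> A `<=` \bigcup_(j in J) T j ->
  (c%:E <= \esum_(j in J) (w j ^+ d')%:E)%E.

Lemma not_tube_null : ~ tube_null A.
Proof.
move=> /(_ (c / 2)); rewrite divr_gt0 // => /(_ isT) [J [T [w [hT hA]]]].
apply/negP; rewrite -ltNge; apply: lt_le_trans (tubes hT hA).
by rewrite lte_fin ltr_pdivrMr // ltr_pMr // ltr1n.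
Qed.

(** A set of diameter less than [w] lies in a tube of width [w] about any line through one of its
    points. *)
Lemma covers (J : set nat) (U : nat -> set 'rV[R]_d) (w : nat -> R) :
  (forall j, 0 < w j) -> (forall j, J j -> (diam (U j) < (w j)%:E)%E) ->
  A `<=` \bigcup_(j in J) U j -> (c%:E <= \esum_(j in J) (w j ^+ d')%:E)%E.
Proof.
move=> w0 hU AU; pose x j := xget 0 (U j).
pose L j : set 'rV[R]_d := [set x j + t *: const_mx 1 | t in [set: R]].
apply: (@tubes J (fun j => [set z | exists2 y, L j y & enorm (z - y) < w j])).
  move=> j _; split => //; exists (L j); split => //.
  exists (x j), (const_mx 1); split => //; apply/eqP => /matrixP /(_ ord0 ord0).
  by rewrite !mxE => /eqP; rewrite oner_eq0.
move=> z /AU [j Jj Uz]; exists j => //=; exists (x j).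
  by exists 0 => //; rewrite scale0r addr0.
rewrite -lte_fin; apply: le_lt_trans (hU _ Jj).
by apply: enorm_le_diam => //; apply: xgetPex; exists z.
Qed.

(** For diameters at most 1, the power [d'] is at most the power [s], so a cheap cover would give a
    cheap family of tubes. *)
Lemma hausdorff_measure_neq0 (s : R) : 0 <= s -> s <= d'%:R ->
  hausdorff_measure s A <> 0%E.
Proof.
move=> s0 sd h0.
(* Widths will be diameters plus margins [y i] of total at most [e]; [exprD_le] then bounds the cost
   by [2 ^ d' * (e + e)], at most [c / 2]. *)
pose e := Num.min 1 (c / (2 ^+ d' * 4)).
have k0 : 0 < 2 ^+ d' :> R by rewrite exprn_gt0.
have e0 : 0 < e by rewrite lt_min ltr01 divr_gt0 // mulr_gt0.
have [U [dU AU hU]] := hausdorff_measure_eq0_cover h0 e0.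
pose y i : R := e / (2 ^ i.+1)%:R.
have y0 i : 0 < y i by rewrite divr_gt0 // ltr0n expn_gt0.
have y1 i : y i <= 1.
  rewrite ler_pdivrMr ?ltr0n ?expn_gt0 // mul1r (@le_trans _ _ 1) ?ge_min ?lexx //.
  by rewrite ler1n expn_gt0.
(* The maximum with 0 replaces the diameter [-oo] of an empty set. *)
pose D i := fine (Order.max 0%E (diam (U i))).
have D0 i : 0 <= D i by rewrite fine_ge0 // le_max lexx.
have DE i : (D i)%:E = Order.max 0%E (diam (U i)).
  rewrite fineK // ge0_fin_numE ?le_max ?lexx // gt_max ltry /=.
  by apply: le_lt_trans (dU i) _; exact: ltry.
have D1 i : D i <= 1 by rewrite -lee_fin DE ge_max dU lee_fin ler01.
have main i : U i !=set0 -> (((D i + y i) ^+ d')%:E <=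
    (2 ^+ d')%:E * (hausdorff_gauge s (U i) + (y i)%:E))%E.
  move=> Un; have [x Ux] := Un.
  rewrite /hausdorff_gauge ifF; last by apply/negbTE/set0P.
  have -> : diam (U i) = (D i)%:E by rewrite DE max_r // (diam_ge0 Ux).
  rewrite poweR_EFin -EFinD -EFinM lee_fin; apply: le_trans (exprD_le _ (D0 i) (ltW (y0 i))) _.
  rewrite ler_pM2l //; apply: lerD; first exact: powR_exprn_le.
  by rewrite -[leRHS]expr1 ler_wiXn2l // ltW.
have : (c%:E <= \esum_(i in [set i | U i !=set0]) ((D i + y i) ^+ d')%:E)%E.
  apply: (@covers _ U (fun i => D i + y i)).
- by move=> i; rewrite ltr_pwDr.
- move=> i _; apply: (@le_lt_trans _ _ (D i)%:E).
    by rewrite DE le_max lexx orbT.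
  by rewrite lte_fin ltrDl.
- by move=> x /AU [i _ Ux]; exists i => //; exists x.
apply/negP; rewrite -ltNge.
apply: (@le_lt_trans _ _ ((2 ^+ d')%:E * (e + e)%:E)%E); last first.
  rewrite -EFinM lte_fin.
  have : e <= c / (2 ^+ d' * 4) by rewrite ge_min lexx orbT.
  by rewrite ler_pdivlMr ?mulr_gt0 //; have := c0; lra.
have g0 i : (0 <= hausdorff_gauge s (U i) + (y i)%:E)%E.
  by rewrite adde_ge0 ?hausdorff_gauge_ge0 // lee_fin ltW.
apply: (@le_trans _ _ (\esum_(i in [set: nat])
    ((2 ^+ d')%:E * (hausdorff_gauge s (U i) + (y i)%:E)))%E).
  rewrite esum_mkcond; apply: le_esum => i _; case: ifPn => [|_].
    by rewrite in_setE; exact: main.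
  by rewrite mule_ge0 // lee_fin ltW.
rewrite -nneseries_esumT; last by move=> i; rewrite mule_ge0 // lee_fin ltW.
rewrite nneseriesZl //; apply: lee_wpmul2l; first by rewrite lee_fin ltW.
apply: le_trans (epsilon_trick _ _ (ltW e0)) _.
  by move=> i; exact: hausdorff_gauge_ge0.
by rewrite EFinD leeD2r.
Qed.

Variables (n : nat -> nat) (D : nat -> R) (U : nat -> nat -> set 'rV[R]_d).
Hypothesis D_gt0 : forall k, 0 < D k.
Hypothesis D_decr : forall k, D k.+1 <= D k.
Hypothesis D_small : forall e : R, 0 < e -> exists k0, forall k, (k0 <= k)%N -> D k <= e.
Hypothesis U_diam : forall k i, (i < n k)%N -> (diam (U k i) <= (D k)%:E)%E.
Hypothesis U_cover : forall k, A `<=` \bigcup_(i in `I_(n k)) U k i.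
(** The count of level [k.+1] is compared with the diameter of the coarser level [k], which covers
    all scales between the two. *)
Hypothesis n_growth : forall s : R, d'%:R < s -> exists k0, forall k,
  (k0 <= k)%N -> (n k.+1)%:R * D k `^ s <= 1.

Lemma hausdorff_measure_above (s : R) : d'%:R < s -> hausdorff_measure s A = 0%E.
Proof.
(* Growth is used at the intermediate exponent [s']; the spare power [s - s'] of [D k] makes the sum
   small. *)
move=> ds; pose s' := (d'%:R + s) / 2.
have ds' : d'%:R < s' by rewrite /s'; lra.
have s's : s' < s by rewrite /s'; lra.
have d00 : 0 <= d'%:R :> R by [].
have s0 : 0 <= s by lra.
apply: hausdorff_measure_eq0 => delta e delta0 e0.
pose e1 := e `^ (s - s')^-1.
have e10 : 0 < e1 by exact: powR_gt0.
have [k1 h1] := n_growth ds'; have [k2 h2] := D_small delta0.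
have [k3 h3] := D_small e10.
pose k := maxn k1 (maxn k2 k3).
have kk1 : (k1 <= k)%N by rewrite leq_maxl.
have kk2 : (k2 <= k)%N by rewrite /k maxnCA leq_maxl.
have kk3 : (k3 <= k)%N by rewrite /k maxnA leq_maxr.
exists (fun i => if (i < n k.+1)%N then U k.+1 i else set0); split.
- move=> i; case: ifP => [ik|_].
    apply: le_trans (U_diam ik) _; rewrite lee_fin; apply: h2.
    exact: leq_trans kk2 (leqnSn _).
  by apply: ge_ereal_sup => _ [[x y] [[]]].
- move=> x /(@U_cover k.+1) [i /= ik Ux]; exists i => //; by rewrite ik.
apply: le_trans (finite_cover_sum s0 (ltW (D_gt0 k.+1)) (@U_diam k.+1)) _.
rewrite lee_fin.
have mono : D k.+1 `^ s <= D k `^ s.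
  by apply: ge0_ler_powR => //; rewrite nnegrE ltW.
apply: le_trans (ler_wpM2l _ mono) _ => //.
have -> : D k `^ s = D k `^ s' * D k `^ (s - s').
  rewrite -powRD; first by rewrite addrC subrK.
  by apply/implyP => _; rewrite gt_eqF.
rewrite mulrA; apply: (@le_trans _ _ (1 * D k `^ (s - s'))).
  by apply: ler_wpM2r; [exact: powR_ge0|exact: h1].
have eE : e = e1 `^ (s - s').
  by rewrite /e1 -powRrM mulVf ?gt_eqF ?subr_gt0 // powRr1 // ltW.
rewrite mul1r eE; apply: ge0_ler_powR.
- by rewrite subr_ge0 ltW.
- by rewrite nnegrE ltW.
- by rewrite nnegrE ltW.
exact: h3.
Qed.

Lemma hausdorff_dim_eq : hausdorff_dim A = (d'%:R)%:E.
Proof.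
apply/eqP; rewrite eq_le; apply/andP; split.
  apply/lee_addgt0Pr => e e0; rewrite -EFinD; apply: ereal_inf_lbound.
  exists (d'%:R + e) => //; split; first by rewrite addr_ge0 // ltW.
  by apply: hausdorff_measure_above; rewrite ltrDl.
apply: le_ereal_inf_tmp => _ [s [s0 hs] <-]; rewrite lee_fin leNgt.
apply/negP => /ltW sd; exact: (hausdorff_measure_neq0 s0 sd).
Qed.

Lemma covering_number_ge (r : R) : 0 < r ->
  ((c / (2 * r) ^+ d')%:E <= covering_number A r)%E.
Proof.
move=> r0; have r20 : 0 < 2 * r by rewrite mulr_gt0.
apply: le_ereal_inf_tmp => _ [m [V [dV AV]] <-].
rewrite lee_fin ler_pdivrMr ?exprn_gt0 // -lee_fin.
apply: le_trans (@covers `I_m V (fun=> 2 * r) _ _ AV) _ => //.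
  move=> j /dV h; apply: le_lt_trans h _; rewrite lte_fin; lra.
rewrite esum_fset; [|exact: finite_II|by move=> *; rewrite lee_fin exprn_ge0 // ltW].
by rewrite -fsbig_ord sumEFin lee_fin sumr_const card_ord -[leLHS]mulr_natl.
Qed.

Lemma covering_number_le k (r : R) : D k <= r ->
  (covering_number A r <= ((n k)%:R)%:E)%E.
Proof.
move=> Dr; apply: ereal_inf_lbound; exists (n k) => //; exists (U k); split.
  by move=> i /U_diam h; apply: le_trans h _; rewrite lee_fin.
exact: U_cover.
Qed.

Lemma box_ratio_le (s r : R) : 0 < r -> r < 1 ->
  (covering_number A r <= (r `^ (- s))%:E)%E -> (box_ratio A r <= s%:E)%E.
Proof.
move=> r0 r1 h; have l0 : 0 < ln r^-1 by rewrite ln_gt0 // invf_gt1.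
have p0 : 0 < r `^ (- s) by exact: powR_gt0.
have -> : s%:E = (lne (r `^ (- s))%:E * ((ln r^-1)^-1)%:E)%E.
  rewrite lne_EFin // -EFinM ln_powR lnV ?posrE // invrN mulNr mulrNN mulfK //.
  by rewrite lt_eqF // -oppr_gt0 -lnV.
apply: lee_wpmul2r; first by rewrite lee_fin invr_ge0 ltW.
rewrite lee_lne // in_itv /= leey andbT; last by rewrite lee_fin ltW.
apply: le_trans (covering_number_ge r0).
by rewrite lee_fin divr_ge0 ?(ltW c0) // exprn_ge0 // mulr_ge0 // ltW.
Qed.

Lemma box_ratio_ge (s r : R) : 0 < r -> r < 1 ->
  ((r `^ (- s))%:E <= covering_number A r)%E -> (s%:E <= box_ratio A r)%E.
Proof.
move=> r0 r1 h; have l0 : 0 < ln r^-1 by rewrite ln_gt0 // invf_gt1.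
have p0 : 0 < r `^ (- s) by exact: powR_gt0.
have -> : s%:E = (lne (r `^ (- s))%:E * ((ln r^-1)^-1)%:E)%E.
  rewrite lne_EFin // -EFinM ln_powR lnV ?posrE // invrN mulNr mulrNN mulfK //.
  by rewrite lt_eqF // -oppr_gt0 -lnV.
apply: lee_wpmul2r; first by rewrite lee_fin invr_ge0 ltW.
rewrite lee_lne // in_itv /= leey andbT; first by rewrite lee_fin ltW.
by apply: le_trans h; rewrite lee_fin ltW.
Qed.

Lemma near0_right (e : R) : 0 < e -> (0 : R)^'+ [set r | 0 < r < e].
Proof.
move=> e0; apply: filterS (filterI (nbhs_right_gt (0 : R)) (nbhs_right_lt e0)).
by move=> r [/= r0 re]; rewrite r0.
Qed.

Lemma upper_box_dim_le : (upper_box_dim A <= (d'%:R)%:E)%E.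
Proof.
apply/lee_addgt0Pr => e e0; rewrite -EFinD; pose s := d'%:R + e.
have ds : d'%:R < s by rewrite ltrDl.
have s0 : 0 <= s by apply: le_trans (ltW ds).
have [k0 hk0] := n_growth ds.
pose V := [set r : R | 0 < r < Num.min 1 (D k0)].
apply: ereal_inf_le; exists (ereal_sup [set box_ratio A r | r in V]).
  by exists V => //; apply: near0_right; rewrite lt_min ltr01 D_gt0.
apply: ge_ereal_sup => _ [r /andP[r0 rmin] <-].
have /andP[r1 rD] : (r < 1) && (r < D k0) by rewrite -lt_min.
apply: box_ratio_le => //.
have exm : exists m, D m <= r.
  by have [m hm] := D_small r0; exists m; exact: hm.
(* Minimality places [r] between [D k.+1] and [D k], where the count is at most
   [n k.+1 <= D k ^ (-s) <= r ^ (-s)]. *)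
case: (ex_minnP exm) => m Dm mmin.
have Dmono a b : (a <= b)%N -> D b <= D a.
  move/subnK <-; elim: (b - a)%N => // i IH; rewrite addSn.
  exact: le_trans (D_decr _) IH.
have k0m : (k0 < m)%N.
  rewrite ltnNge; apply/negP => /Dmono h.
  by have := le_trans h Dm; rewrite leNgt rD.
case: m k0m Dm mmin => // k k0k Dk kmin.
have rDk : r < D k by rewrite ltNge; apply/negP => /kmin; rewrite ltnn.
apply: le_trans (covering_number_le Dk) _; rewrite lee_fin powRN.
have := hk0 k k0k; rewrite -ler_pdivlMr ?powR_gt0 // mul1r => h.
apply: le_trans h _; rewrite lef_pV2 ?posrE ?powR_gt0 //.
by apply: ge0_ler_powR; rewrite ?nnegrE // ltW.
Qed.

Lemma lower_box_dim_ge : ((d'%:R)%:E <= lower_box_dim A)%E.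
Proof.
apply/lee_addgt0Pr => e e0; rewrite -leeBlDr // -EFinB; pose s := d'%:R - e.
pose M := c / 2 ^+ d'; have M0 : 0 < M by rewrite divr_gt0 // exprn_gt0.
(* For such [r] the constant [M] is absorbed: [r ^ e <= M]. *)
pose V := [set r : R | 0 < r < Num.min 1 (M `^ e^-1)].
rewrite /lower_box_dim limf_einfE.
apply: (@le_trans _ _ (ereal_inf [set box_ratio A r | r in V])); last first.
  apply: ereal_sup_ubound; exists V => //; apply: near0_right.
  by rewrite lt_min ltr01 powR_gt0.
apply: le_ereal_inf_tmp => _ [r /andP[r0 rmin] <-].
have /andP[r1 rM] : (r < 1) && (r < M `^ e^-1) by rewrite -lt_min.
apply: box_ratio_ge => //; apply: le_trans (covering_number_ge r0).
have rd0 : 0 < r ^+ d' by rewrite exprn_gt0.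
rewrite lee_fin exprMn invfM mulrA -/M ler_pdivlMr // -powR_mulrn ?(ltW r0) //.
rewrite -powRD; last by apply/implyP => _; rewrite gt_eqF.
have -> : - (d'%:R - e) + d'%:R = e by rewrite opprB subrK.
have -> : M = (M `^ e^-1) `^ e.
  by rewrite -powRrM mulVf ?gt_eqF // powRr1 // ltW.
by apply: ge0_ler_powR; rewrite ?nnegrE ?powR_ge0 // ltW.
Qed.

Lemma lower_le_upper_box_dim : (lower_box_dim A <= upper_box_dim A)%E.
Proof.
rewrite /lower_box_dim limf_einfE; apply: ge_ereal_sup => _ [V FV <-].
apply: le_ereal_inf_tmp => _ [W FW <-].
have [r [Vr Wr]] := filter_ex (filterI FV FW).
apply: (@le_trans _ _ (box_ratio A r)).
  by apply: ereal_inf_lbound; exists r.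
by apply: ereal_sup_ubound; exists r.
Qed.

Lemma has_box_dim_eq : has_box_dim A (d'%:R)%:E.
Proof.
split; apply/eqP; rewrite eq_le.
  by rewrite lower_box_dim_ge (le_trans lower_le_upper_box_dim upper_box_dim_le).
by rewrite upper_box_dim_le (le_trans lower_box_dim_ge lower_le_upper_box_dim).
Qed.

End Dimensions.

(** * Pure unrectifiability from gaps much larger than diameters *)

Section Unrectifiable.
Variables (R : realType) (d : nat).

Lemma hausdorff_null_bigcup s (B : nat -> set 'rV[R]_d) :
  (forall k, hausdorff_null s (B k)) -> hausdorff_null s (\bigcup_k B k).
Proof.
move=> hB delta e delta0 e0.
have p0 k : 0 < e / (2 ^ k.+1)%:R by rewrite divr_gt0 // ltr0n expn_gt0.
pose V k := sval (cid (hB k delta _ delta0 (p0 k))).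
have hV k : [/\ forall i, (diam (V k i) <= delta%:E)%E, B k `<=` \bigcup_i V k i &
     (\sum_(0 <= i <oo) hausdorff_gauge s (V k i) <= (e / (2 ^ k.+1)%:R)%:E)%E].
  by rewrite /V; case: cid.
have /ppcard_eqP[f] := card_esym card_nat2.
exists (fun m => V (f m).1 (f m).2); split.
- by move=> m; have [] := hV (f m).1.
- move=> x [k _ Bx]; have [_ /(_ x Bx) [i _ Vx] _] := hV k.
  have [m _ fm] := @surj _ _ _ _ f (k, i) I.
  by exists m => //; rewrite fm.
rewrite nneseries_esumT; last by move=> m; exact: hausdorff_gauge_ge0.
have g0 k i : (0 <= hausdorff_gauge s (V k i))%E by exact: hausdorff_gauge_ge0.
rewrite -(@reindex_esum _ _ _ [set: nat] [set: nat * nat] f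
   (fun p => hausdorff_gauge s (V p.1 p.2))) //; last first.
rewrite (_ : [set: nat * nat] = [set: nat] `*`` (fun=> [set: nat])); last first.
  by apply/seteqP; split.
rewrite -(@esum_esum _ _ _ _ _ (fun k i => hausdorff_gauge s (V k i))) //.
apply: (@le_trans _ _ (\sum_(0 <= k <oo) (0 + (e / (2 ^ k.+1)%:R)%:E))%E).
  rewrite nneseries_esumT; last by move=> k; rewrite add0e lee_fin ltW.
  apply: le_esum => k _; rewrite add0e -nneseries_esumT //.
  by have [] := hV k.
apply: le_trans (@epsilon_trick R (fun=> 0%E) e xpredT _ (ltW e0)) _ => //.
by rewrite eseries0 // add0e.
Qed.

Lemma hausdorff_nullS s (B B' : set 'rV[R]_d) : B `<=` B' ->
  hausdorff_null s B' -> hausdorff_null s B.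
Proof.
move=> BB h delta e d0 e0; have [V [dV BV hV]] := h _ _ d0 e0; exists V; split => //.
exact: subset_trans BB BV.
Qed.

(** A single [q] bounds both the Lipschitz constant and the inverse of the scale, so that countably
    many pieces exhaust the curve. *)
Definition lipschitz_near (g : R -> 'rV[R]_d) (q t : R) : Prop :=
  forall u, `|u - t| <= q^-1 -> `|g u - g t| <= q * `|u - t|.

Lemma derivable_lipschitz_near (g : R -> 'rV[R]_d) t : derivable g t 1 ->
  exists2 k : nat, `|t| <= k%:R & lipschitz_near g k.+1%:R t.
Proof.
move=> /cvg_ex[l /cvgrPdist_lt /(_ 1 ltr01)]; rewrite near_withinE.
move=> /nbhs_ballP[eta /= eta0 heta].
have lip h : `|h| < eta -> `|g (t + h) - g t| <= (`|l| + 1) * `|h|.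
  move=> hh; have [->|hn0] := eqVneq h 0; first by rewrite addr0 subrr !normr0 mulr0.
  have := heta h; rewrite -ball_normE /= sub0r normrN => /(_ hh hn0).
  rewrite /= [h *: 1]mulr1 [h + t]addrC distrC => hl.
  have : `|h^-1 *: (g (t + h) - g t)| <= `|l| + 1.
    rewrite -[_ *: _](subrK l); apply: le_trans (ler_normD _ _) _.
    by rewrite addrC lerD2l ltW.
  by rewrite normrZ normfV mulrC ler_pdivrMr // normr_gt0.
pose M := `|l| + 1 + eta^-1 + `|t|.
have ei0 : 0 < eta^-1 by rewrite invr_gt0.
have MM := truncnS_gt M; set k := (Num.truncn M).+1 in MM.
have nl := normr_ge0 l; have nt := normr_ge0 t.
have kk : k%:R <= k.+1%:R :> R by rewrite ler_nat.
exists k; first by rewrite /M in MM; lra.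
move=> u hu; have lt : `|u - t| < eta.
  apply: le_lt_trans hu _; rewrite invf_plt ?posrE ?ltr0n //.
  by rewrite /M in MM; lra.
have := lip _ lt; rewrite [t + _]addrC subrK => h; apply: le_trans h _.
by apply: ler_wpM2r => //; rewrite /M in MM; lra.
Qed.

Variables (A : set 'rV[R]_d) (rad sep : nat -> R).
Hypothesis rad_gt0 : forall k, 0 < rad k.
Hypothesis sep_gt0 : forall k, 0 < sep k.
Hypothesis sep_le1 : forall k, sep k <= 1.
Hypothesis rad_sep : forall e : R, 0 < e -> exists k, rad k <= e * sep k.
Hypothesis separated : forall k x y, A x -> A y -> `|x - y| < sep k ->
  `|x - y| <= 2 * rad k.

(** On a parameter interval of length [sep l / (2 * q)] the points of [A] on the curve are closer
    than [sep l], hence within [2 * rad l]. There are about [q^2 / sep l] such intervals, so the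
    total length is of order [q^2 * rad l / sep l]. *)
Lemma lipschitz_piece_null (g : R -> 'rV[R]_d) (k : nat) :
  hausdorff_null 1
    (A `&` g @` [set t | `|t| <= k%:R /\ lipschitz_near g k.+1%:R t]).
Proof.
move=> delta e delta0 e0; set S := [set t | _ /\ _]; pose q : R := k.+1%:R.
have q1 : 1 <= q by rewrite ler1n.
have q0 : 0 < q by exact: lt_le_trans ltr01 q1.
have kq : k%:R <= q :> R by rewrite ler_nat.
pose dd : R := d.+1%:R.
have dd0 : 0 < dd by rewrite ltr0n.
(* The first bound gives diameters at most [delta], the second a sum at most [e]: 12 is [3 * 2 * 2],
   from [m * h <= 3 * q], the diameter [2 * rad l] and [h = sep l / (2 * q)]. *)
pose e1 := Num.min (delta / (2 * dd)) (e / (12 * dd * q ^+ 2)).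
have e10 : 0 < e1 by rewrite lt_min !divr_gt0 // !mulr_gt0 // exprn_gt0.
have [l hl] := rad_sep e10.
have r0 := rad_gt0 l; have s0 := sep_gt0 l; have s1 := sep_le1 l.
pose h := sep l / (2 * q); have h0 : 0 < h by rewrite divr_gt0 // mulr_gt0.
have qh : q * h = sep l / 2 by rewrite /h; field; rewrite gt_eqF.
pose r := dd * (2 * rad l).
have r00 : 0 < r by rewrite !mulr_gt0.
have rdelta : r <= delta.
  have : rad l <= delta / (2 * dd) * 1.
    apply: le_trans hl _; apply: ler_pM => //; first exact: ltW.
      exact: ltW.
    by rewrite ge_min lexx.
  by rewrite mulr1 ler_pdivlMr ?mulr_gt0 // /r; lra.
pose m := (Num.truncn (2 * q / h)).+1.
pose V i : set 'rV[R]_d :=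
  A `&` g @` (S `&` [set t | i%:R * h <= t + q < i.+1%:R * h]).
have dV i : (diam (V i) <= r%:E)%E.
  apply: (@le_trans _ _ (d%:R * (2 * rad l))%:E); last first.
    rewrite lee_fin /r; apply: ler_wpM2r; last by rewrite /dd ler_nat.
    by rewrite mulr_ge0 // ltW.
  apply: diam_le_sup => x y [Ax [t [[tk tl] /andP[t1 t2]] tx]].
  move=> [Ay [u [[uk ul] /andP[u1 u2]] uy]].
  rewrite -tx in Ax *; rewrite -uy in Ay *.
  rewrite -natr1 mulrDl mul1r in t2; rewrite -natr1 mulrDl mul1r in u2.
  have tu : `|t - u| <= h by rewrite ler_norml; lra.
  apply: (separated Ax Ay); apply: le_lt_trans (ul t _) _.
    apply: le_trans tu _; rewrite /h invfM mulrA ler_piMl ?invr_ge0 ?(ltW q0) //.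
    by lra.
  apply: le_lt_trans (_ : _ <= q * h) _; first by rewrite ler_pM2l.
  by rewrite qh; lra.
exists (fun i => if (i < m)%N then V i else set0); split.
- move=> i; case: ifP => _; last by apply: ge_ereal_sup => _ [[x y] [[]]].
  by apply: le_trans (dV i) _; rewrite lee_fin.
- move=> x [Ax [t St tx]]; rewrite -tx in Ax *; have [tk tl] := St.
  have tq : 0 <= (t + q) / h.
    by rewrite divr_ge0 ?(ltW h0) //; move: tk; rewrite ler_norml => /andP[]; lra.
  exists (Num.truncn ((t + q) / h)) => //; rewrite ifT.
    split => //; exists t => //; split => //=.
    have /andP[h1 h2] := truncn_itv tq.
    by rewrite -ler_pdivlMr // -ltr_pdivrMr // h1.
  rewrite /m ltnS le_truncn // ler_pM2r ?invr_gt0 //.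
  by move: tk; rewrite ler_norml => /andP[]; lra.
apply: le_trans (finite_cover_sum (n := m) ler01 (ltW r00) (fun i _ => dV i)) _.
rewrite lee_fin powRr1 ?(ltW r00) //.
have q2 : 0 <= 2 * q / h by rewrite divr_ge0 ?(ltW h0) //; lra.
have mh : m%:R * h <= 3 * q.
  have : m%:R <= 2 * q / h + 1 by rewrite /m -natr1 lerD2r truncn_le.
  rewrite -(ler_pM2r h0) mulrDl divfK ?gt_eqF // mul1r => H; apply: le_trans H _.
  have : q * h <= q * 1 by rewrite qh; lra.
  have : h <= q * h by rewrite ler_peMl // ltW.
  lra.
rewrite -(ler_pM2r h0) mulrAC.
have : rad l <= e / (12 * dd * q ^+ 2) * sep l.
  by apply: le_trans hl _; rewrite ler_pM2r // ge_min lexx orbT.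
rewrite [leRHS]mulrAC ler_pdivlMr ?mulr_gt0 ?exprn_gt0 // => H.
apply: le_trans (_ : 3 * q * r <= _); first by rewrite ler_pM2r.
rewrite -(ler_pM2l q0) [q * (e * h)]mulrCA qh /r; move: H; rewrite expr2; lra.
Qed.

Lemma separated_purely_unrectifiable : purely_unrectifiable A.
Proof.
move=> G [I [g [hd _ ->]]]; apply: hausdorff_measure_eq0.
have := hausdorff_null_bigcup (lipschitz_piece_null g).
apply: hausdorff_nullS => x [Ax [t It tx]]; rewrite -tx in Ax *.
have [k tk tl] := derivable_lipschitz_near (hd t It).
by exists k => //; split => //; exists t.
Qed.

End Unrectifiable.

(** * Arithmetic of the exponents *)

Section Exponents.
Variables (d' c : nat).
Let d := d'.+1.

(** Base-2 logarithms of [b] and [N]; the summand [c * k.+1] of [expo_N] is that of [m]. Up to a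
    bounded error, [expo_sum] is the logarithm of the inverse radius. *)
Definition expo_b (k : nat) : nat := (c * k.+1 ^ 2)%N.
Definition expo_N (k : nat) : nat := (c * k.+1 + d' * expo_b k)%N.
Definition expo_sum (k : nat) : nat := (\sum_(i < k) (expo_N i + expo_b i))%N.

Lemma expo_le k : (expo_N k + expo_b k <= 2 * d * c * k.+1 ^ 2)%N.
Proof. rewrite /expo_N /expo_b /d; nia. Qed.

Lemma expo_sum_le k : (expo_sum k.+1 <= 2 * d * c * k.+1 ^ 3)%N.
Proof.
apply: (@leq_trans (\sum_(i < k.+1) 2 * d * c * k.+1 ^ 2)%N).
  apply: leq_sum => i _; apply: leq_trans (expo_le i) _.
  by rewrite leq_mul2l leq_exp2r // ltn_ord orbT.
by rewrite sum_nat_const card_ord mulnC -mulnA -expnSr.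
Qed.

Lemma expo_sum_ge k : (0 < c)%N -> (k ^ 3 <= 3 * expo_sum k)%N.
Proof.
move=> c0; elim: k => // k IH; rewrite /expo_sum big_ord_recr /= -/(expo_sum k).
have : (k.+1 ^ 2 <= expo_b k)%N by rewrite leq_pmull.
have -> : (k.+1 ^ 3 = k ^ 3 + 3 * k ^ 2 + 3 * k + 1)%N by lia.
have -> : (k.+1 ^ 2 = k ^ 2 + 2 * k + 1)%N by lia.
by move: IH (expo_N k) (expo_b k) => IH x y; lia.
Qed.

(** From [d * expo_N = d' * (expo_N + expo_b) + c * k.+1]. The count of cubes thus exceeds dimension
    [d'] only by a quadratic term, against the cubic [expo_sum]. *)
Lemma expo_N_sum k : (\sum_(i < k) d * expo_N i <= d' * expo_sum k + c * k ^ 2)%N.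
Proof.
apply: (@leq_trans (\sum_(i < k) (d' * (expo_N i + expo_b i) + c * k))%N).
  apply: leq_sum => i _; have := ltn_ord i; rewrite /expo_N /expo_b /d; nia.
by rewrite big_split /= -big_distrr sum_nat_const card_ord /= leq_add2l mulnCA.
Qed.

End Exponents.

(* Left: base-2 logarithm of the cardinal of the net of lines. Right: the
   exponent of the Chernoff bound. *)
Lemma expo_prob d' k (c := (64 + 4 * d'.+1)%N) :
  (2 * d'.+1 * (expo_sum d' c k.+1 + k + 14) < 2 ^ (c * k.+1 - 4 * k - 17))%N.
Proof.
have h := expo_sum_le d' c k; set d := d'.+1 in h *; set n := k.+1 in h *.
(* The left side will be at most [34 * d ^ 2 * c * n ^ 3]; the bound [2 ^ (c - 20) * 2 ^ (3 * n)]
   has exactly the required exponent when [k = 0]. *)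
have dc : (34 * d ^ 2 * c <= 2 ^ (c - 20))%N.
  have dd : (d < 2 ^ d)%N := ltn_expl d (ltnSn 1).
  have d16 : (16 + d < 2 ^ (16 + d))%N := ltn_expl _ (ltnSn 1).
  apply: (@leq_trans (2 ^ 6 * (2 ^ d) ^ 2 * (2 ^ 2 * 2 ^ (16 + d)))%N).
    apply: leq_mul; last by rewrite /c; lia.
    by apply: leq_mul => //; rewrite leq_exp2r // ltnW.
  by rewrite -expnM -!expnD leq_exp2l // /c; lia.
have n3 : (n ^ 3 <= 2 ^ (3 * n))%N.
  by rewrite [(3 * n)%N]mulnC expnM leq_exp2r // ltnW // ltn_expl.
apply: (@leq_trans (34 * d ^ 2 * c * n ^ 3)%N).
  have n1 : (n <= n ^ 3)%N by rewrite -{1}[n]expn1 leq_pexp2l.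
  have c64 : (64 <= c)%N by rewrite leq_addr.
  have d1 : (1 <= d)%N by [].
  have n0 : (1 <= n)%N by [].
  apply: (@leq_trans (2 * d * (2 * d * c * n ^ 3 + 14 * n ^ 3) + n ^ 3)%N).
    rewrite -addn1; apply: leq_add; last exact: leq_trans n0 n1.
    by rewrite leq_mul2l; apply/orP; right; rewrite -addnA leq_add // /n; lia.
  by move: (n ^ 3)%N => x; nia.
apply: (@leq_trans (2 ^ (c - 20) * 2 ^ (3 * n))%N); first exact: leq_mul.
by rewrite -expnD leq_exp2l // /n /c; nia.
Qed.

(** * Choice of the parameters and assembly *)

Section Construction.
Variables (R : realType) (d' : nat).
Let d := d'.+1.
Let c := (64 + 4 * d)%N.

Let N k := (2 ^ expo_N d' c k)%N.
Let b k := (2 ^ expo_b c k)%N.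
Let gam k : R := 2 ^- k.+3.
Let r k := cell_rad N b gam k.
Let P := expo_sum d' c.

Let N0 k : (0 < N k)%N. Proof. by rewrite expn_gt0. Qed.
Let b0 k : (0 < b k)%N. Proof. by rewrite expn_gt0. Qed.
Let gam0 k : 0 < gam k. Proof. by rewrite invr_gt0 exprn_gt0. Qed.

Let gamS k : gam k.+1 = gam k / 2.
Proof. by rewrite /gam exprS invfM mulrC. Qed.

Let gam8 k : gam k <= 8^-1.
Proof.
elim: k => [|k IH]; first by rewrite /gam lef_pV2 ?posrE ?exprn_gt0 //; lra.
by rewrite gamS; have := gam0 k; lra.
Qed.

Let gam1 k : gam k <= 2^-1. Proof. by have := gam8 k; lra. Qed.

Let gamb_geo k : 2 ^+ k.+1 <= gam k * (b k)%:R.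
Proof.
rewrite /gam mulrC ler_pdivlMr ?exprn_gt0 // -exprD natrX ler_weXn2l ?ler1n //.
rewrite /expo_b /c; nia.
Qed.

Let gamb k : 2 <= gam k * (b k)%:R.
Proof.
by apply: le_trans (gamb_geo k); rewrite -[leLHS]expr1 ler_weXn2l // ler1n.
Qed.

Let prod_Nb k : \prod_(i < k) (N i * b i)%:R = 2 ^+ P k :> R.
Proof.
rewrite /P /expo_sum -natrX expn_sum natr_prod; apply: eq_bigr => i _.
by rewrite expnD.
Qed.

Let rad_prod k : r k * 2 ^+ P k = \prod_(i < k) (1 - gam i) ^+ 2.
Proof.
rewrite -prod_Nb /r; elim: k => [|k IH]; first by rewrite !big_ord0 mulr1.
have Nb0 : (N k * b k)%:R != 0 :> R by rewrite pnatr_eq0 -lt0n muln_gt0 N0 b0.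
rewrite !big_ord_recr /= -IH.
by move: (N k * b k)%:R Nb0 => B B0; field.
Qed.

(** The term [4 * gam k] reserves twice the tail of the geometric series, which makes the induction
    close; it is an equality at [k = 0]. *)
Let prod_gam_ge k : 2^-1 + 4 * gam k <= \prod_(i < k) (1 - gam i) ^+ 2.
Proof.
elim: k => [|k IH]; first by rewrite big_ord0 /gam; lra.
rewrite big_ord_recr /= gamS; have g0 := gam0 k; have g8 := gam8 k.
apply: (@le_trans _ _ ((2^-1 + 4 * gam k) * (1 - gam k) ^+ 2)).
  by move: (gam k) g0 g8 => x x0 x8; nra.
by apply: ler_wpM2r => //; exact: sqr_ge0.
Qed.

Let prod_gam_le1 k : \prod_(i < k) (1 - gam i) ^+ 2 <= 1.
Proof.
apply: prodr_ile1 => i _; rewrite sqr_ge0 /= -[leRHS](expr1n _ 2%N).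
by rewrite lerXn2r ?nnegrE //; have := gam0 i; have := gam8 i; lra.
Qed.

Let rad_ge k : 1 <= 2 * r k * \prod_(i < k) (N i * b i)%:R.
Proof.
by rewrite prod_Nb -mulrA rad_prod; have := prod_gam_ge k; have := gam0 k; lra.
Qed.

Let rad_geP k : 2^-1 <= r k * 2 ^+ P k.
Proof. by rewrite rad_prod; have := prod_gam_ge k; have := gam0 k; lra. Qed.

Let rad_leP k : r k <= 2 ^- P k.
Proof. by rewrite -[leRHS]mul1r ler_pdivlMr ?exprn_gt0 // rad_prod. Qed.

Let eps_prod k : \prod_(i < k) (1 + gam i) <= 2.
Proof.
suff : \prod_(i < k) (1 + gam i) <= 2 - 8 * gam k by have := gam0 k; lra.
elim: k => [|k IH]; first by rewrite big_ord0 /gam; lra.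
rewrite big_ord_recr /= gamS; have g0 := gam0 k; have g8 := gam8 k.
apply: (@le_trans _ _ ((2 - 8 * gam k) * (1 + gam k))).
  by apply: ler_wpM2r => //; lra.
by move: (gam k) g0 g8 => x x0 x8; nra.
Qed.

Let PS k : P k.+1 = (P k + (expo_N d' c k + expo_b c k))%N.
Proof. by rewrite /P /expo_sum big_ord_recr. Qed.

(** The mesh must be finer than [gam * sig], of order [2^(-k - 3 - P k.+1)]; the constant 14 leaves
    [2^11 / 4 = 512 > 432]. *)
Let K k := (2 ^ (P k.+1 + k + 14)).-1.

Let KE k : (K k).+1%:R = 2 ^+ P k * (N k * b k)%:R * 2 ^+ k * 2 ^+ 14 :> R.
Proof.
rewrite /K prednK ?expn_gt0 // natrX PS /N /b natrM !natrX !exprD; ring.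
Qed.

Let net_fine k :
  432 < (K k).+1%:R * (gam k * ((1 - gam k) * r k / (N k * b k)%:R)).
Proof.
have Nb0 : (N k * b k)%:R != 0 :> R by rewrite pnatr_eq0 -lt0n muln_gt0 N0 b0.
have g8 := gam8 k; have h := rad_geP k.
have -> : (K k).+1%:R * (gam k * ((1 - gam k) * r k / (N k * b k)%:R)) =
    2 ^+ 11 * (1 - gam k) * (r k * 2 ^+ P k).
  rewrite KE {1}/gam; move: (N k * b k)%:R Nb0 => B B0; rewrite !exprS expr0.
  by field; rewrite B0 /= expf_neq0.
have : 2 ^+ 11 * 2^-1 * 2^-1 <= 2 ^+ 11 * (1 - gam k) * (r k * 2 ^+ P k).
  by apply: ler_pM => //; rewrite ?mulr_ge0 ?exprn_ge0 // ler_pM2l ?exprn_gt0 //; lra.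
lra.
Qed.

Let net_small k : (K k).+1%:R ^+ (2 * d) *
  expR (- ((2 ^- (2 * k + 8) : R) ^+ 2 * (N k * b k)%:R / (2 * (b k)%:R ^+ d))) < 1.
Proof.
have hk : (2 * d * (P k.+1 + k + 14) < 2 ^ (c * k.+1 - 4 * k - 17))%N.
  exact: expo_prob.
(* [X] is the logarithm of the net size. [2 ^ Y] is [e1^2 * m / 2], with [m = 2 ^ (c * k.+1)] and
   [e1^2 = 2^(-4k - 16)]. *)
pose X := (2 * d * (P k.+1 + k + 14))%N; pose Y := (c * k.+1 - 4 * k - 17)%N.
rewrite -/X -/Y in hk.
have -> : (2 ^- (2 * k + 8) : R) ^+ 2 * (N k * b k)%:R / (2 * (b k)%:R ^+ d) =
    (2 ^ Y)%:R :> R.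
  have -> : (N k * b k)%:R = 2 ^+ (c * k.+1) * (b k)%:R ^+ d :> R.
    rewrite /N /b natrM !natrX /expo_N -exprM -!exprD; congr (_ ^+ _).
    by rewrite /d; move: (expo_b c k) => x; nia.
  have -> : (c * k.+1 = Y + (4 * k + 17))%N by rewrite /Y /c; nia.
  have bd : (b k)%:R ^+ d != 0 :> R by rewrite expf_neq0 // pnatr_eq0 -lt0n.
  have -> : (4 * k + 17 = (2 * k + 8) * 2 + 1)%N by lia.
  rewrite exprVn -exprM natrX addnA.
  move: ((2 * k + 8) * 2)%N => x; rewrite !exprD expr1.
  by field; rewrite bd expf_neq0.
rewrite /K prednK ?expn_gt0 // -natrX -expnM mulnC -/X.
have e2 : (2 : R) <= expR 1 by have := expR_ge1Dx (1 : R); lra.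
have h : (2 ^ X)%:R <= expR X%:R :> R.
  rewrite natrX -[X in expR X]mulr1 expRM_natl.
  by rewrite lerXn2r ?nnegrE ?expR_ge0.
apply: le_lt_trans (ler_wpM2r (expR_ge0 _) h) _.
by rewrite -expRD expR_lt1 subr_lt0 ltr_nat.
Qed.

Let rad0 k : 0 < r k. Proof. exact: rad_gt0. Qed.

Let exists_offsets k : exists C : seq 'rV[R]_d,
    [/\ size C = (N k ^ d)%N,
        forall x, x \in C -> `|x| + (1 - gam k) * r k / (N k * b k)%:R <= r k,
        forall x y, x \in C -> y \in C -> x != y ->
          2 * gam k * (r k / (N k)%:R) <= `|x - y| &
        forall a v, `|a| <= 6 -> `|v| = 1 ->
          \sum_(x <- C) chord (a - x) v ((1 + gam k.+1) * r k.+1) <=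
          (1 + gam k) / (b k)%:R ^+ d * chord a v ((1 + gam k) * r k)].
Proof.
(* Chosen so that the relative error [4 * e1 / gam k] equals [gam k], a summable sequence. *)
pose e1 : R := 2 ^- (2 * k + 8).
have e10 : 0 < e1 by rewrite invr_gt0 exprn_gt0.
have e11 : e1 <= 1 by rewrite invf_le1 ?exprn_gt0 // exprn_ege1 // ler1n.
have r1 : r k <= 1 by exact: rad_le1.
have sig0 : 0 < (1 - gam k) * r k / (N k * b k)%:R.
  by rewrite divr_gt0 ?mulr_gt0 ?ltr0n ?muln_gt0 ?N0 ?b0 //; have := gam8 k; lra.
have hr' : (1 + gam k.+1) * r k.+1 <=
    (1 - gam k / 2) * ((1 - gam k) * r k / (N k * b k)%:R).
  have -> : r k.+1 = (1 - gam k) * ((1 - gam k) * r k / (N k * b k)%:R).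
    by rewrite /r radS.
  rewrite [leLHS]mulrA ler_pM2r // gamS; have := gam0 k; nra.
have [C [C1 C2 C3 C4]] := one_step_offsets (N0 k) (b0 k) (rad0 k) r1 (gam0 k)
  (gam1 k) e10 e11 (net_fine k) (net_small k) hr'.
exists C; split => // a v a6 v1; apply: le_trans (C4 a v a6 v1) _.
suff -> : 4 * e1 / gam k = gam k by [].
rewrite /e1 /gam; have -> : (2 * k + 8 = k.+3 + k.+3 + 2)%N by lia.
by rewrite !exprD; field; rewrite expf_neq0.
Qed.

Let offs k := sval (cid (exists_offsets k)).

Let offsP k : [/\ size (offs k) = (N k ^ d)%N,
        forall x, x \in offs k -> `|x| + (1 - gam k) * r k / (N k * b k)%:R <= r k,
        forall x y, x \in offs k -> y \in offs k -> x != y ->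
          2 * gam k * (r k / (N k)%:R) <= `|x - y| &
        forall a v, `|a| <= 6 -> `|v| = 1 ->
          \sum_(x <- offs k) chord (a - x) v ((1 + gam k.+1) * r k.+1) <=
          (1 + gam k) / (b k)%:R ^+ d * chord a v ((1 + gam k) * r k)].
Proof. by rewrite /offs; case: cid. Qed.

Let offs_size k : size (offs k) = (N k ^ d)%N. Proof. by case: (offsP k). Qed.

Let A := limit_set N b gam offs.

Let size_centersE k :
  ((size (centers offs k))%:R : R) <= 2 `^ (d' * P k + c * k ^ 2)%:R.
Proof.
rewrite (size_centers offs_size) powR_mulrn // -natrX ler_nat.
under eq_bigr do rewrite /N -expnM mulnC.
by rewrite -expn_sum leq_exp2l //; exact: expo_N_sum.
Qed.

Let growth (s : R) : d'%:R < s -> exists k0, forall k, (k0 <= k)%N ->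
  (size (centers offs k.+1))%:R * (d%:R * (2 * r k)) `^ s <= 1.
Proof.
(* [B] collects the coefficients of [k ^ 2] in the exponent of 2, by [k.+1 ^ 2 <= 4 * k ^ 2]. The
   gain [(s - d') * P k] is cubic in [k] and wins from [k0] on. *)
move=> ds; pose B : R := 4 * (2 * d * d' * c + c)%:R + 2 * d%:R * s.
have s0 : 0 < s by apply: le_lt_trans ds.
pose k0 := (Num.truncn (3 * B / (s - d'%:R))).+1; exists k0 => k k0k.
have sd : 0 < s - d'%:R by rewrite subr_gt0.
have kB : 3 * B <= k%:R * (s - d'%:R).
  rewrite -ler_pdivrMr //; apply: ltW; apply: lt_le_trans (truncnS_gt _) _.
  by rewrite ler_nat.
have D2 : d%:R * (2 * r k) <= 2 `^ (2 * d%:R - (P k)%:R).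
  have e1 : (2 : R) `^ (2 * d%:R) = 2 ^+ (2 * d) by rewrite -natrM powR_mulrn.
  rewrite powRB ?pnatr_eq0 ?implybT // e1 powR_mulrn // mulrA.
  apply: ler_pM; rewrite ?mulr_ge0 ?(ltW (rad0 k)) //.
  by rewrite mulrC -natrM -natrX ler_nat; apply: ltnW; exact: ltn_expl.
have h1 : (size (centers offs k.+1))%:R * (d%:R * (2 * r k)) `^ s <=
    2 `^ (d' * P k.+1 + c * k.+1 ^ 2)%:R * (2 `^ (2 * d%:R - (P k)%:R)) `^ s.
  apply: ler_pM => //; first exact: powR_ge0.
  apply: ge0_ler_powR; rewrite ?nnegrE ?powR_ge0 ?(ltW s0) //.
  by rewrite !mulr_ge0 // ltW.
apply: le_trans h1 _; rewrite -powRrM -powRD; last by rewrite pnatr_eq0 implybT.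
rewrite -[leRHS](powRr0 (2 : R)); apply: ler_powR; first by rewrite ler1n.
have k1 : (1 <= k)%N by apply: leq_trans k0k.
have hP : (d' * P k.+1 + c * k.+1 ^ 2 <= d' * P k + (2 * d * d' * c + c) * (4 * k ^ 2))%N.
  rewrite PS; have := expo_le d' c k.
  have : (k.+1 ^ 2 <= 4 * k ^ 2)%N by nia.
  move: (expo_N _ _ _ + expo_b _ _)%N (k.+1 ^ 2)%N (4 * k ^ 2)%N => x y z yz xy.
  have : (d' * x <= d' * (2 * d * c * y))%N by rewrite leq_mul2l xy orbT.
  have : ((2 * d * d' * c + c) * y <= (2 * d * d' * c + c) * z)%N by rewrite leq_mul2l yz orbT.
  nia.
have hPr : (d' * P k.+1 + c * k.+1 ^ 2)%:R <=
    d'%:R * (P k)%:R + (2 * d * d' * c + c)%:R * (4 * k%:R ^+ 2) :> R.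
  by move: hP; rewrite -(ler_nat R) => h; apply: le_trans h _; rewrite !(natrD, natrM, natrX).
have kP : k%:R ^+ 3 <= 3 * (P k)%:R :> R.
  by rewrite -natrX -natrM ler_nat; apply: expo_sum_ge.
have k2 : 1 <= k%:R ^+ 2 :> R by rewrite exprn_ege1 // ler1n.
have h2 : 3 * B * k%:R ^+ 2 <= (s - d'%:R) * (3 * (P k)%:R).
  apply: (@le_trans _ _ ((s - d'%:R) * k%:R ^+ 3)); last by rewrite ler_pM2l.
  rewrite (exprS _ 2) mulrA ler_wpM2r ?exprn_ge0 //.
  by rewrite [leRHS]mulrC.
have h3 : 2 * d%:R * s <= 2 * d%:R * s * k%:R ^+ 2.
  by rewrite ler_peMr // !mulr_ge0 // ltW.
by move: h2 hPr h3; rewrite /B; lra.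
Qed.

Lemma exists_limit_set : (0 < d')%N -> exists A : set 'rV[R]_d,
  [/\ purely_unrectifiable A, hausdorff_dim A = (d'%:R)%:E,
      has_box_dim A (d'%:R)%:E & ~ tube_null A].
Proof.
move=> d'0.
have offs_norm k := let: And4 _ h _ _ := offsP k in h.
have offs_sep k := let: And4 _ _ h _ := offsP k in h.
have offs_chord k := let: And4 _ _ _ h := offsP k in h.
have tubes := limit_set_tubes N0 b0 gam0 gam1 gamb (fun k => ltW (gam0 k))
  offs_size offs_norm offs_chord eps_prod rad_ge.
have c0 : 0 < (12 * 2 ^+ d * 9 ^+ d')^-1 :> R.
  by rewrite invr_gt0 !mulr_gt0 ?exprn_gt0.
have D0 k : 0 < d%:R * (2 * r k) by rewrite !mulr_gt0 // ltr0n.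
have Dd k : d%:R * (2 * r k.+1) <= d%:R * (2 * r k).
  by rewrite !ler_pM2l ?ltr0n //; exact: radS_le.
have Ds (e : R) : 0 < e -> exists k0, forall k, (k0 <= k)%N -> d%:R * (2 * r k) <= e.
  move=> e0; have [|k0 hk] := @rad_small _ N b gam N0 b0 gam0 gam1 gamb (e / (d%:R * 2)).
    by rewrite divr_gt0 // mulr_gt0 // ltr0n.
  exists k0 => k /hk; rewrite ler_pdivlMr ?mulr_gt0 ?ltr0n // => h.
  by rewrite mulrA mulrC.
have Ud k i : (i < size (centers offs k))%N ->
    (diam (cell N b gam offs k i) <= (d%:R * (2 * r k))%:E)%E.
  by move=> _; apply: diam_le_sup => x y; exact: cell_diam.
have Uc k := @limit_set_cells _ _ N b gam offs k.
exists A; split.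
- pose sep k : R := 2 * gam k * (r k / (N k)%:R) / 2.
  apply: (@separated_purely_unrectifiable _ _ A (fun k => r k.+1) sep).
  + by move=> k; exact: rad0.
  + move=> k; have Nk : 0 < (N k)%:R :> R by rewrite ltr0n.
    apply: divr_gt0 => //; apply: mulr_gt0; first exact: mulr_gt0.
    exact: divr_gt0.
  + move=> k; have h : r k / (N k)%:R <= 1.
      rewrite ler_pdivrMr ?ltr0n // mul1r; apply: (@le_trans _ _ 1); first exact: rad_le1.
      by rewrite ler1n.
    have h0 : 0 <= r k / (N k)%:R by rewrite divr_ge0 // ltW.
    by rewrite /sep; have := gam8 k; have := gam0 k; nra.
  (* The ratio of diameter to gap is at most [1 / (gam k * b k)], and [gam k * b k] is at least
     [2 ^ k.+1]. *)
  + move=> e e0; pose k := (Num.truncn e^-1).+1; exists k.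
    have ke : e^-1 <= gam k * (b k)%:R.
      apply: le_trans (gamb_geo k); apply: ltW; apply: lt_le_trans (truncnS_gt _) _.
      by rewrite -/k -natrX ler_nat ltnW // ltnW // ltn_expl.
    have := @radS_sep _ N b gam N0 b0 gam0 gam1 k; rewrite -/(r k) -/(r k.+1) => h.
    rewrite -ler_pdivrMl // mulrC.
    apply: le_trans (_ : r k.+1 * (gam k * (b k)%:R) <= _).
      by rewrite ler_pM2l.
    by rewrite /sep; lra.
  + move=> k x y; exact: (limit_set_separated N0 b0 gam0 gam1 gamb offs_norm offs_sep).
- exact: (hausdorff_dim_eq d'0 c0 tubes D0 Dd Ds Ud Uc growth).
- exact: (has_box_dim_eq c0 tubes D0 Dd Ds Ud Uc growth).
- exact: (not_tube_null c0 tubes).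
Qed.

End Construction.

Theorem theorem1p1 (R : realType) (d : nat) (hd : (2 <= d)%N) :
  exists A : set 'rV[R]_d,
    [/\ purely_unrectifiable A,
        hausdorff_dim A = (d.-1%:R : R)%:E,
        has_box_dim A (d.-1%:R : R)%:E &
        ~ tube_null A].
Proof. by case: d hd => // d' hd; exact: exists_limit_set. Qed.
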